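(* Let $S$ be a Hausdorff topological space, with $\mathcal{B}(S)$ denoting its Borel sigma algebra. Let $\mathfrak{P}_r(S)$ be the space of all Radon probability measures on $S$ and let $\mathcal{B}(\mathfrak{P}_r(S))$ be the Borel sigma algebra on $\mathfrak{P}_r(S)$ with respect to the $A$-topology on $\mathfrak{P}_r(S)$. Let $(\Omega, \mathcal{F}, \mathbb{P})$ be a probability space and let $X_1, X_2, \ldots$ be a sequence of exchangeable $S$-valued random variables on it such that the common distribution of the $X_i$ is Radon on $S$. Then there exists a unique Radon probability measure $\mathscr{P}$ on $(\mathfrak{P}_r(S), \mathcal{B}(\mathfrak{P}_r(S)))$ such that, for all $k \in \mathbb{N}$, $$\mathbb{P}(X_1 \in B_1, \ldots, X_k \in B_k) = \int_{\mathfrak{P}_r(S)} \mu(B_1)\cdots \mu(B_k)\, d\mathscr{P}(\mu) \quad \text{for all } B_1, \ldots, B_k \in \mathcal{B}(S).$$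
   Context: An $S$-valued random variable is an $(\mathcal{F},\mathcal{B}(S))$-measurable map $\Omega\to S$. The sequence $(X_n)_{n\in\mathbb{N}}$ is exchangeable if $\mathbb{P}(X_1\in B_1,\ldots,X_k\in B_k)=\mathbb{P}(X_{\sigma(1)}\in B_1,\ldots,X_{\sigma(k)}\in B_k)$ for all $k\in\mathbb{N}$, all permutations $\sigma$ of $\{1,\ldots,k\}$ and all $B_1,\ldots,B_k\in\mathcal{B}(S)$. A Borel probability measure $\mu$ on a Hausdorff space $T$ is Radon if $\mu(B)=\sup\{\mu(K): K\subseteq B,\ K \text{ compact}\}$ for every $B\in\mathcal{B}(T)$. The $A$-topology on $\mathfrak{P}_r(S)$ is the coarsest topology for which $\mu\mapsto\int_S f\,d\mu$ is upper semicontinuous for every bounded upper semicontinuous $f\colon S\to\mathbb{R}$; equivalently, it is generated by the subbasis of sets $\{\mu\in\mathfrak{P}_r(S):\mu(G)>\alpha\}$ with $G\subseteq S$ open and $\alpha\in\mathbb{R}$. It is a Hausdorff topology when $S$ is Hausdorff, and the evaluation maps $\mu\mapsto\mu(B)$, $B\in\mathcal{B}(S)$, are Borel measurable on $\mathfrak{P}_r(S)$. *)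

(* Defs.v *)
From HB Require Import structures.
From mathcomp Require Import all_boot all_order all_fingroup all_algebra.
From mathcomp Require Import all_classical all_reals all_analysis.

Set Implicit Arguments.
Unset Strict Implicit.
Unset Printing Implicit Defensive.

Import Order.TTheory GRing.Theory Num.Theory.
Import numFieldNormedType.Exports.

Local Open Scope classical_set_scope.
Local Open Scope ring_scope.
Local Open Scope ereal_scope.

Notation borel S := (g_sigma_algebraType (@open S)).

Definition borel_set (S : ptopologicalType) : set (set S) :=
  @measurable _ (borel S).

Definition upper_semicontinuous (S : topologicalType) (R : numFieldType)
    (f : S -> \bar R) := forall x (a : R), f x < a%:E ->
  exists2 V, nbhs x V & forall y, V y -> f y < a%:E.

Lemma upper_semicontinuousP (S : topologicalType) (R : numFieldType)
    (f : S -> \bar R) :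
  upper_semicontinuous f <-> forall a : R, open [set x | f x < a%:E].
Proof.
split=> [usc a|openf x a fxa].
  rewrite openE => x /= /usc[V xV Vf]; exact: filterS xV.
by exists [set y | f y < a%:E] => //; exact: open_nbhs_nbhs.
Qed.

Definition radon (S : ptopologicalType) (R : realType)
    (mu : set (borel S) -> \bar R) := forall B, borel_set B ->
  mu B = ereal_sup [set mu K | K in [set K : set S | K `<=` B /\ compact K]].

(* A library measure is a function on all sets, whose values on non-measurable
   sets are unconstrained. Requiring these to be given by the induced outer
   measure makes each Radon probability measure on the Borel sets correspond to
   exactly one element of this type (see [radon_probability_eq] and
   [radon_probability_of]). *)
Record radon_probability (R : realType) (S : ptopologicalType) :=
  RadonProbability {
    radon_probability_val :> probability (borel S) R ;
    radon_probability_radon : radon radon_probability_val ;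
    radon_probability_ext : forall A : set S,
      radon_probability_val A = mu_ext radon_probability_val A }.

Lemma eq_mu_ext (R : realType) (S : ptopologicalType)
    (mu nu : set (borel S) -> \bar R) :
  (forall A, borel_set A -> mu A = nu A) -> mu_ext mu = mu_ext nu.
Proof.
move=> munu; apply/funext => A; congr ereal_inf.
apply: eq_imagel => F [mF _]; apply: eq_eseriesr => k _; exact: munu (mF k).
Qed.

Lemma radon_probability_eq (R : realType) (S : ptopologicalType)
    (mu nu : radon_probability R S) :
  (forall A : set S, borel_set A -> mu A = nu A) -> mu = nu.
Proof.
move=> munu.
have {munu} : mu = nu :> (set (borel S) -> \bar R).
  apply/funext => A; rewrite !radon_probability_ext.
  by rewrite (eq_mu_ext munu).
case: mu nu => [mu hmu omu] [nu hnu onu] /= munu.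
have E : mu = nu.
  move: munu {hmu omu hnu onu}.
  case: mu => [m [[a1 a2] [b] [c] [e] [f] [g] [h]]].
  case: nu => [n [[a1' a2'] [b'] [c'] [e'] [f'] [g'] [h']]] /= mn.
  move: a1 a2 b c e f g h a1' a2' b' c' e' f' g' h'; rewrite -{}mn.
  move=> a1 a2 b c e f g h a1' a2' b' c' e' f' g' h'.
  have <- := Prop_irrelevance a1 a1'; have <- := Prop_irrelevance a2 a2'.
  have <- := Prop_irrelevance b b'; have <- := Prop_irrelevance c c'.
  have <- := Prop_irrelevance e e'; have <- := Prop_irrelevance f f'.
  by have <- := Prop_irrelevance g g'; have <- := Prop_irrelevance h h'.
move: hmu omu hnu onu; rewrite {munu}E => hmu omu hnu onu.
by rewrite (Prop_irrelevance hmu hnu) (Prop_irrelevance omu onu).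
Qed.

Section borel_extension.
Variables (R : realType) (S : ptopologicalType).
Variables (mu : probability (borel S) R).

Definition borel_extension : set (borel S) -> \bar R := mu_ext mu.

Lemma borel_extensionE A : borel_set A -> borel_extension A = mu A.
Proof. exact: measurable_mu_extE. Qed.

Let borel_extension0 : borel_extension set0 = 0.
Proof. by rewrite borel_extensionE ?measure0//; exact: (@measurable0 _ (borel S)). Qed.

Let borel_extension_ge0 A : 0 <= borel_extension A.
Proof. exact: mu_ext_ge0. Qed.

Let borel_extension_sigma_additive : semi_sigma_additive borel_extension.
Proof.
move=> F mF tF mUF; rewrite borel_extensionE//.
under eq_fun do under eq_bigr do rewrite (borel_extensionE (mF _)).
exact: measure_semi_sigma_additive.
Qed.

HB.instance Definition _ := isMeasure.Build _ _ _ borel_extension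
  borel_extension0 borel_extension_ge0 borel_extension_sigma_additive.

Let borel_extensionT : borel_extension [set: borel S] = 1.
Proof. by rewrite borel_extensionE ?probability_setT//; exact: (@measurableT _ (borel S)). Qed.

HB.instance Definition _ :=
  Measure_isProbability.Build _ _ _ borel_extension borel_extensionT.

Lemma borel_extension_ext A : borel_extension A = mu_ext borel_extension A.
Proof. by rewrite (eq_mu_ext borel_extensionE). Qed.

End borel_extension.

Lemma borel_compact (S : ptopologicalType) (K : set S) :
  hausdorff_space S -> compact K -> borel_set K.
Proof.
move=> hS cK; rewrite -(setCK K).
apply: (@measurableC _ (borel S)).
by apply: sub_sigma_algebra; apply: closed_openC; exact: compact_closed.
Qed.

Lemma radon_probability_of (R : realType) (S : ptopologicalType)
    (hS : hausdorff_space S) (mu : probability (borel S) R) :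
  radon mu ->
  exists nu : radon_probability R S, forall A, borel_set A -> nu A = mu A.
Proof.
move=> rmu; have rnu : radon (borel_extension mu).
  move=> B mB; rewrite borel_extensionE// rmu//; congr ereal_sup.
  by apply: eq_imagel => K [_ cK]; rewrite borel_extensionE//; exact: borel_compact.
exists (RadonProbability rnu (borel_extension_ext mu)) => A mA /=.
exact: borel_extensionE.
Qed.

Lemma radon_dirac (R : realType) (S : ptopologicalType) (x : borel S) :
  radon (borel_extension (dirac x : probability (borel S) R)).
Proof.
move=> B mB; apply/eqP; rewrite eq_le; apply/andP; split; last first.
  by apply: ge_ereal_sup => _ [K [KB _] <-]; exact: le_mu_ext.
rewrite borel_extensionE//= diracE; have [xB|xB] := boolP (x \in B).
  apply: (@le_trans _ _ (borel_extension (dirac x : probability _ R) [set x])).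
    apply: le_ereal_inf_tmp => _ [F [mF xF] <-].
    apply: (@le_trans _ _ (\d_x (\bigcup_k F k))).
      by rewrite diracE mem_set//; exact: xF.
    by apply: measure_sigma_subadditive => //; exact: bigcupT_measurable.
  apply: ereal_sup_ubound; exists [set x] => //; split; last exact: compact_set1.
  by move=> _ ->; rewrite -in_setE.
apply: ereal_sup_ubound; exists set0; last by rewrite measure0.
by split => //; exact: compact0.
Qed.

HB.instance Definition _ (R : realType) (S : ptopologicalType) :=
  gen_eqMixin (radon_probability R S).
HB.instance Definition _ (R : realType) (S : ptopologicalType) :=
  gen_choiceMixin (radon_probability R S).

(* Measurable types are pointed, hence so is the Borel space of
   [radon_probability R S]. *)
HB.instance Definition _ (R : realType) (S : ptopologicalType) :=
  isPointed.Build (radon_probability R S)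
    (RadonProbability (@radon_dirac R S point) (borel_extension_ext _)).

(* The A-topology: sublevel sets of the maps mu |-> \int f dmu, with f bounded
   upper semicontinuous, form a subbasis of the coarsest topology making all
   these maps upper semicontinuous. *)
HB.instance Definition _ (R : realType) (S : ptopologicalType) :=
  @isSubBaseTopological.Build (radon_probability R S)
    ((S -> R) * R)%type
    [set fa | bounded_fun fa.1 /\ upper_semicontinuous (EFin \o fa.1)]
    (fun fa => [set mu : radon_probability R S |
                 \int[mu]_x (fa.1 x)%:E < fa.2%:E]).

Definition exchangeable d (Omega : measurableType d) d' (T : measurableType d')
    (R : realType) (P : probability Omega R) (X : nat -> {RV P >-> T}) :=
  forall (k : nat) (s : 'S_k) (B : 'I_k -> set T),
    (forall i, measurable (B i)) ->
    P [set w | forall i : 'I_k, B i (X i w)] =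
    P [set w | forall i : 'I_k, B i (X (s i) w)].

Arguments exchangeable {d Omega d' T R} P X.

(* Main.v *)
Require Import Defs.
From HB Require Import structures.
From mathcomp Require Import all_boot all_order all_fingroup all_algebra finmap.
From mathcomp Require Import all_classical all_reals all_analysis.
From mathcomp Require Import measurable_realfun ring lra.

Set Implicit Arguments.
Unset Strict Implicit.
Unset Printing Implicit Defensive.

Import Order.TTheory GRing.Theory Num.Theory.
Import numFieldNormedType.Exports.

Local Open Scope classical_set_scope.
Local Open Scope ring_scope.

(** The mixing measure [Pi] is obtained as a limit of the laws of the empirical
    measures [mu_n], the uniform distributions on the first terms of [X].

    A finite-additivity argument replaces weak compactness. Let [GG] be a base
    of open sets of a Hausdorff space, closed under finite unions and
    intersections, and let [lam] be a modular monotone function on [GG] that is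
    tight and gives mass [1] to the whole space. Then [kap K], the infimum of [lam] over the members of [GG] that
    contain the compact set [K], is modular on compact sets, because disjoint
    compact sets have disjoint neighbourhoods in [GG]. The inner measure of
    [kap] is a Radon probability measure whose values on [GG] are at most those
    of [lam] ([radon_of_content]). Ultrafilter limits of tight families of
    contents satisfy the hypotheses ([radon_of_ultralimit]).

    This is used twice. On [S] it shows that, for compact sets [K j] and levels
    [eps j] tending to [0], the Radon measures giving at most [eps j] to the
    complement of [K j] for every [j] form a compact set in the A-topology
    ([A_compact]). On the space of Radon measures, with the laws of the [mu_n]
    as contents, Markov's inequality and [A_compact] give tightness, and the
    resulting Radon measure is [Pi] ([mixing_measure_exists]).

    For open sets [G i] the product of the evaluations [mu |-> mu (G i)] is a
    lower semicontinuous function, so its integral under [Pi] is at most the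
    limit of its expectations at [mu_n]. Expanding the product and using
    exchangeability, these expectations tend to the probability that [X i] lies
    in [G i] for all [i] ([expect_empirical_prod]). Outer regularity extends
    this inequality to Borel sets. Summed over the [2 ^ k] cells of the
    partition generated by the [B i], both sides are [1], so equality holds.

    For uniqueness, the moments determine the integrals of polynomials in the
    evaluations [mu |-> mu B]. Bounded sequences of such polynomials separate
    pointwise a compact set from the complement of an open neighbourhood
    ([compact_eval_separated]), so two mixing measures [Pi1] and [Pi2] satisfy
    [Pi1 K <= Pi2 V] whenever [K] is compact, [V] is open and [K] is contained
    in [V]. Radon measures are determined by such inequalities. *)

(** * Compact sets *)

Section compact_sets.
Context {T : topologicalType}.

(** Otherwise the sets [A] for which [K `\` A] has the property would form a
    proper filter on [K] without cluster point.  This induction replaces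
    arguments with finite subcovers. *)
Lemma compact_ind (K : set T) (P : set T -> Prop) : compact K ->
  P set0 -> (forall A B, A `<=` B -> P B -> P A) ->
  (forall A B, P A -> P B -> P (A `|` B)) ->
  (forall x, K x -> exists2 U, nbhs x U & P U) -> P K.
Proof.
move=> cK P0 Psub PU Ploc; apply: contrapT => nPK.
pose F := [set A | P (K `\` A)].
have FF : ProperFilter F.
  apply: Build_ProperFilter; first by rewrite /F /= setD0.
  split=> [|A B FA FB|A B AB FA]; rewrite /F /=.
  - by rewrite setDT.
  - by rewrite setDIr; exact: PU.
  - by apply: Psub FA => x [Kx nBx]; split=> // /AB.
have [|x [Kx clx]] := cK F FF; first by rewrite /F /= setDv.
have [U Ux PUU] := Ploc x Kx.
have FU : F (~` U) by apply: Psub PUU => y [Ky /contrapT].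
by have [y [nUy Uy]] := clx _ _ FU Ux.
Qed.

Lemma compact_setD (K O : set T) : compact K -> open O -> compact (K `\` O).
Proof. by move=> cK oO; apply: compact_closedI => //; exact: open_closedC. Qed.

(** Every point has a neighbourhood that is contained in [O] or misses some
    [D n], so [compact_ind] applies to [D 0]. *)
Lemma decreasing_compact_sub (D : nat -> set T) (O : set T) :
  hausdorff_space T -> (forall n, compact (D n)) ->
  (forall n, D n.+1 `<=` D n) -> open O -> \bigcap_n D n `<=` O ->
  exists N, D N `<=` O.
Proof.
move=> hT cD Ddec oO DO.
have Dmono m n : (m <= n)%N -> D n `<=` D m.
  elim: n => [|n IH]; first by rewrite leqn0 => /eqP ->.
  rewrite leq_eqVlt => /predU1P[->//|]; rewrite ltnS => /IH; exact: subset_trans.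
suff [N HN] : exists N, D 0%N `&` D N `<=` O.
  by exists N => x DNx; apply: HN; split => //; exact: Dmono DNx.
apply: (@compact_ind _ (fun A => exists N, A `&` D N `<=` O) (cD 0%N)).
- by exists 0%N; rewrite set0I.
- by move=> A B AB [N HN]; exists N => x [/AB Bx DNx]; exact: HN.
- move=> A B [N HN] [M HM]; exists (maxn N M) => x [[Ax|Bx] Dx].
    by apply: HN; split => //; apply: Dmono Dx; exact: leq_maxl.
  by apply: HM; split => //; apply: Dmono Dx; exact: leq_maxr.
- move=> x _; have [Ox|nOx] := pselect (O x).
    by exists O; [exact: open_nbhs_nbhs|exists 0%N => y []].
  have [n nDnx] : exists n, ~ D n x.
    by apply/existsNP => Dx; apply: nOx; apply: DO => n _; exact: Dx.
  exists (~` D n); last by exists n => y [].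
  by apply: open_nbhs_nbhs; split => //; exact/closed_openC/(compact_closed hT).
Qed.

End compact_sets.

Section open_base.
Context {T : topologicalType} (hT : hausdorff_space T) (GG : set (set T)).
Hypothesis GGopen : forall G, GG G -> open G.
Hypothesis GG0 : GG set0.
Hypothesis GGU : forall G H, GG G -> GG H -> GG (G `|` H).
Hypothesis GGI : forall G H, GG G -> GG H -> GG (G `&` H).
Hypothesis GGbase : forall x O, open O -> O x ->
  exists G, [/\ GG G, G x & G `<=` O].

Lemma compact_base_sub (K O : set T) : compact K -> open O -> K `<=` O ->
  exists G, [/\ GG G, K `<=` G & G `<=` O].
Proof.
move=> cK oO KO.
apply: (@compact_ind _ K (fun A => exists G, [/\ GG G, A `<=` G & G `<=` O]) cK).
- by exists set0; split.
- by move=> A B AB [G [? BG ?]]; exists G; split => //; exact: subset_trans BG.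
- move=> A B [G [gG AG GO]] [H [gH BH HO]]; exists (G `|` H); split.
  + exact: GGU.
  + exact: setUSS.
  + by rewrite subUset.
- move=> x /KO Ox; have [G [gG Gx GO]] := GGbase oO Ox.
  exists G; last by exists G; split.
  by apply: open_nbhs_nbhs; split => //; exact: GGopen.
Qed.

Lemma compact_base_separation (K L : set T) : compact K -> compact L ->
  K `&` L = set0 ->
  exists U V, [/\ GG U, GG V, K `<=` U, L `<=` V & U `&` V = set0].
Proof.
move=> cK cL KL.
have sub0 (A B C D : set T) : A `<=` B -> C `<=` D -> B `&` D = set0 ->
    A `&` C = set0.
  by rewrite -!subset0 => AB CD; apply: subset_trans; exact: setISS.
have pointwise x : K x ->
    exists U V, [/\ GG U, GG V, U x, L `<=` V & U `&` V = set0].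
  move=> Kx; pose P A := exists U V,
    [/\ GG U, GG V, U x, A `<=` V & U `&` V = set0].
  apply: (@compact_ind _ L P cL).
  - have [G [gG Gx _]] := GGbase (@openT T) (I : [set: T] x).
    by exists G, set0; split => //; rewrite setI0.
  - move=> A B AB [U [V [? ? ? BV ?]]]; exists U, V; split => //.
    exact: subset_trans BV.
  - move=> A B [U [V [gU gV Ux AV UV]]] [U' [V' [gU' gV' Ux' BV' UV']]].
    exists (U `&` U'), (V `|` V'); split; [exact: GGI|exact: GGU|by []| |].
      exact: setUSS.
    by rewrite setIUr (@sub0 _ U _ V)// (@sub0 _ U' _ V')// setU0.
  - move=> y Ly; have xy : x != y.
      apply/eqP => xy; have : (K `&` L) x by split => //; rewrite xy.
      by rewrite KL.
    have : ~ cluster (nbhs x) y by move=> /hT xy'; rewrite xy' eqxx in xy.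
    move=> /existsNP[A /existsNP[B /not_implyP[xA /not_implyP[yB AB]]]].
    rewrite nbhsE in xA; case: xA => A' [oA A'x] A'A.
    rewrite nbhsE in yB; case: yB => B' [oB B'y] B'B.
    have [U [gU Ux UA]] := GGbase oA A'x; have [V [gV Vy VB]] := GGbase oB B'y.
    have UV : U `&` V = set0.
      by apply/seteqP; split=> // z [/UA/A'A Az /VB/B'B Bz]; apply: AB; exists z.
    exists V; last by exists U, V; split.
    by apply: open_nbhs_nbhs; split => //; exact: GGopen.
pose P A := exists U V, [/\ GG U, GG V, A `<=` U, L `<=` V & U `&` V = set0].
apply: (@compact_ind _ K P cK).
- have [V [gV LV _]] := compact_base_sub cL (@openT T) (@subsetT _ _).
  by exists set0, V; split => //; rewrite set0I.
- move=> A B AB [U [V [? ? BU ? ?]]]; exists U, V; split => //.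
  exact: subset_trans BU.
- move=> A B [U [V [gU gV AU LV UV]]] [U' [V' [gU' gV' BU' LV' UV']]].
  exists (U `|` U'), (V `&` V'); split; [exact: GGU|exact: GGI| | |].
  + exact: setUSS.
  + by rewrite subsetI.
  + by rewrite setIUl (@sub0 _ U _ V)// (@sub0 _ U' _ V')// setU0.
- move=> x Kx; have [U [V [gU gV Ux LV UV]]] := pointwise x Kx.
  exists U; last by exists U, V; split.
  by apply: open_nbhs_nbhs; split => //; exact: GGopen.
Qed.

End open_base.

(** * Radon measures from contents *)

Section content_extension.
Context {R : realType} {T : ptopologicalType} (hT : hausdorff_space T).
Variables (GG : set (set T)) (lam : set T -> R).
Hypothesis GGopen : forall G, GG G -> open G.
Hypothesis GG0 : GG set0.
Hypothesis GGT : GG setT.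
Hypothesis GGU : forall G H, GG G -> GG H -> GG (G `|` H).
Hypothesis GGI : forall G H, GG G -> GG H -> GG (G `&` H).
Hypothesis GGbase : forall x O, open O -> O x ->
  exists G, [/\ GG G, G x & G `<=` O].
Hypothesis lam0 : lam set0 = 0.
Hypothesis lamT : lam setT = 1.
Hypothesis le_lam : forall G H, GG G -> GG H -> G `<=` H -> lam G <= lam H.
Hypothesis lamUI : forall G H, GG G -> GG H ->
  lam (G `|` H) + lam (G `&` H) = lam G + lam H.
Hypothesis lam_tight : forall e : R, 0 < e ->
  exists K, compact K /\ forall G, GG G -> K `<=` G -> 1 - e <= lam G.

Let lam_ge0 G : GG G -> 0 <= lam G.
Proof. by move=> gG; rewrite -lam0; exact: le_lam. Qed.

Let kap (K : set T) : R := inf [set lam G | G in [set G | GG G /\ K `<=` G]].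

Let kap_has_inf K : has_inf [set lam G | G in [set G | GG G /\ K `<=` G]].
Proof.
split; first by exists (lam setT), setT.
by exists 0 => _ [G [gG _] <-]; exact: lam_ge0.
Qed.

Let kap_le K G : GG G -> K `<=` G -> kap K <= lam G.
Proof.
by move=> gG KG; apply: ge_inf; [case: (kap_has_inf K)|exists G].
Qed.

Let kap_approx K e : 0 < e -> exists G, [/\ GG G, K `<=` G & lam G < kap K + e].
Proof.
move=> /inf_adherent /(_ (kap_has_inf K)) [_ [G [gG KG] <-] lG].
by exists G; split.
Qed.

Let kap_ge K c : (forall G, GG G -> K `<=` G -> c <= lam G) -> c <= kap K.
Proof.
move=> h; apply: lb_le_inf; first by case: (kap_has_inf K).
by move=> _ [G [gG KG] <-]; exact: h.
Qed.

Let le_kap K L : K `<=` L -> kap K <= kap L.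
Proof.
by move=> KL; apply: kap_ge => G gG LG; apply: kap_le => //; exact: subset_trans LG.
Qed.

Let kap_ge0 K : 0 <= kap K.
Proof. by apply: kap_ge => G gG _; exact: lam_ge0. Qed.

Let kap_le1 K : kap K <= 1.
Proof. by rewrite -lamT; apply: kap_le. Qed.

Let kap0 : kap set0 = 0.
Proof. by apply/eqP; rewrite eq_le kap_ge0 -lam0 kap_le. Qed.

Let kap_submodular K L : kap (K `|` L) + kap (K `&` L) <= kap K + kap L.
Proof.
apply/ler_addgt0Pr => e e0; have e20 : 0 < e / 2 by lra.
have [G [gG KG lG]] := kap_approx K e20.
have [H [gH LH lH]] := kap_approx L e20.
have := kap_le (GGU gG gH) (setUSS KG LH).
have := kap_le (GGI gG gH) (setISS KG LH).
have := lamUI gG gH; lra.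
Qed.

(** The separation of the disjoint compact sets [K `\` G] and [L `\` G] by
    open sets turns modularity on open sets into modularity on compact
    sets. *)
Let kap_supermodular K L : compact K -> compact L ->
  kap K + kap L <= kap (K `|` L) + kap (K `&` L).
Proof.
move=> cK cL; apply/ler_addgt0Pr => e e0; have e20 : 0 < e / 2 by lra.
have [H [gH KLH lH]] := kap_approx (K `|` L) e20.
have [G [gG KLG lG]] := kap_approx (K `&` L) e20.
have oG := GGopen gG.
have [|U [V [gU gV KU LV UV]]] := compact_base_separation hT GGopen GG0 GGU GGI
    GGbase (compact_setD cK oG) (compact_setD cL oG).
  by apply/seteqP; split=> // x [[Kx nGx] [Lx _]]; apply: nGx; exact: KLG.
pose G1 := (G `|` U) `&` H; pose G2 := (G `|` V) `&` H.
have gG1 : GG G1 by apply: GGI => //; exact: GGU.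
have gG2 : GG G2 by apply: GGI => //; exact: GGU.
have KG1 : K `<=` G1.
  move=> x Kx; split; last by apply: KLH; left.
  by have [Gx|nGx] := pselect (G x); [left|right; apply: KU].
have LG2 : L `<=` G2.
  move=> x Lx; split; last by apply: KLH; right.
  by have [Gx|nGx] := pselect (G x); [left|right; apply: LV].
have UG : G1 `|` G2 `<=` H by move=> x [|] [].
have IG : G1 `&` G2 `<=` G.
  move=> x [[[//|Ux] _] [[//|Vx] _]].
  by have : (U `&` V) x by []; rewrite UV.
have := le_lam (GGU gG1 gG2) gH UG; have := le_lam (GGI gG1 gG2) gG IG.
have := lamUI gG1 gG2; have := kap_le gG1 KG1; have := kap_le gG2 LG2; lra.
Qed.

Let iota (A : set T) : R :=
  sup [set kap K | K in [set K | compact K /\ K `<=` A]].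

Let iota_has_sup A : has_sup [set kap K | K in [set K | compact K /\ K `<=` A]].
Proof.
split; first by exists (kap set0), set0 => //; split => //; exact: compact0.
by exists 1 => _ [K _ <-].
Qed.

Let iota_ge A K : compact K -> K `<=` A -> kap K <= iota A.
Proof.
by move=> cK KA; apply: ub_le_sup; [case: (iota_has_sup A)|exists K].
Qed.

Let iota_approx A e : 0 < e ->
  exists K, [/\ compact K, K `<=` A & iota A - e < kap K].
Proof.
move=> /sup_adherent /(_ (iota_has_sup A)) [_ [K [cK KA] <-] lK].
by exists K; split.
Qed.

Let iota_le A c : (forall K, compact K -> K `<=` A -> kap K <= c) -> iota A <= c.
Proof.
move=> h; apply: ge_sup; first by case: (iota_has_sup A).
by move=> _ [K [cK KA] <-]; exact: h.
Qed.

Let iota_compact K : compact K -> iota K = kap K.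
Proof.
move=> cK; apply/eqP; rewrite eq_le iota_ge// andbT.
by apply: iota_le => L _; exact: le_kap.
Qed.

Let iota_le1 A : iota A <= 1.
Proof. exact: iota_le. Qed.

Let le_iota A B : A `<=` B -> iota A <= iota B.
Proof.
by move=> AB; apply: iota_le => K cK KA; apply: iota_ge => //; exact: subset_trans AB.
Qed.

Let iotaT : iota setT = 1.
Proof.
apply/eqP; rewrite eq_le iota_le1/=; apply/ler_addgt0Pr => e e0.
have [K [cK hK]] := lam_tight e0.
by have := iota_ge cK (@subsetT _ K); have := kap_ge hK; lra.
Qed.

Let iota0 : iota set0 = 0.
Proof. by rewrite iota_compact//; exact: compact0. Qed.

(** Iterating [kap (K `&` L) >= kap K + kap L - 1] over compact subsets of the
    [A n] gives compact sets that decrease into their intersection, and a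
    neighbourhood of the limit already contains one of them. *)
Let iota_bigcap (A : nat -> set T) (s : R) :
  (forall n, \sum_(i < n) (1 - iota (A i)) <= s) ->
  1 - s <= iota (\bigcap_n A n).
Proof.
move=> hs; apply/ler_addgt0Pr => e e0.
have h n : exists K, [/\ compact K, K `<=` A n &
    iota (A n) - e / (2 ^+ n.+1) < kap K].
  by apply: iota_approx; rewrite divr_gt0// exprn_gt0.
pose K n := sval (cid (h n)).
have hK n : [/\ compact (K n), K n `<=` A n &
    iota (A n) - e / (2 ^+ n.+1) < kap (K n)] by exact: svalP (cid (h n)).
have cK n : compact (K n) by case: (hK n).
pose D := fix D n := if n is m.+1 then D m `&` K m.+1 else K 0%N.
have cD n : compact (D n).
  elim: n => [|n IH] /=; first exact: cK.
  by apply: compact_closedI => //; exact: compact_closed.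
have Ddec n : D n.+1 `<=` D n by move=> x [].
have kapD n : 1 - \sum_(i < n.+1) (1 - kap (K i)) <= kap (D n).
  elim: n => [|n IH]; first by rewrite big_ord1 /=; lra.
  rewrite big_ord_recr/=.
  have := kap_supermodular (cD n) (cK n.+1).
  have := kap_le1 (D n `|` K n.+1); lra.
have sumK n : \sum_(i < n) (1 - kap (K i)) <=
    \sum_(i < n) (1 - iota (A i)) + e - e / 2 ^+ n.
  elim: n => [|n IH]; first by rewrite !big_ord0; lra.
  rewrite !big_ord_recr/=; have [_ _] := hK n.
  have : e / 2 ^+ n = e / 2 ^+ n.+1 + e / 2 ^+ n.+1.
    by rewrite exprS; field; rewrite expf_neq0.
  by move: IH; lra.
have cC : compact (\bigcap_n D n).
  apply: (subclosed_compact _ (cD 0%N)); last exact: bigcap_inf.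
  by apply: closed_bigI => n _; exact: compact_closed.
have CA : \bigcap_n D n `<=` \bigcap_n A n.
  move=> x Cx n _; have [_ + _] := hK n; apply.
  by have := Cx n I; case: (n) => [//|m []].
have := iota_ge cC CA; suff : 1 - s - e <= kap (\bigcap_n D n) by lra.
apply: kap_ge => G gG CG.
have [N DNG] := decreasing_compact_sub hT cD Ddec (GGopen gG) CG.
have := kap_le gG DNG; have := kapD N; have := sumK N.+1; have := hs N.+1.
have : 0 <= e / 2 ^+ N.+1 by rewrite divr_ge0// ?ltW// exprn_gt0.
lra.
Qed.

Let mstar (A : set T) : \bar R := (1 - iota (~` A))%:E.

Let mstar0 : mstar set0 = 0%E.
Proof. by rewrite /mstar setC0 iotaT subrr. Qed.

Let mstar_ge0 A : (0 <= mstar A)%E.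
Proof. by rewrite lee_fin subr_ge0. Qed.

Let le_mstar : {homo mstar : A B / A `<=` B >-> (A <= B)%E}.
Proof.
by move=> A B AB; rewrite lee_fin lerD2l lerN2; apply: le_iota; exact: subsetC.
Qed.

(** The outer measure [A |-> 1 - iota (~` A)] inherits countable subadditivity
    from [iota_bigcap] by taking complements. *)
Let mstar_sigma_subadditive : sigma_subadditive mstar.
Proof.
move=> F; have sum_ge0 : (0 <= \sum_(i <oo) mstar (F i))%E by exact: nneseries_ge0.
case E : (\sum_(i <oo) mstar (F i))%E => [s| |]; last 2 first.
- by rewrite leey.
- by rewrite E in sum_ge0.
rewrite lee_fin setC_bigcup.
suff : 1 - s <= iota (\bigcap_n ~` F n) by lra.
apply: iota_bigcap => n; rewrite -lee_fin -E -sumEFin.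
rewrite -(big_mkord xpredT (fun i => (1 - iota (~` F i))%:E)).
by apply: nneseries_lim_ge => i _ _; exact: mstar_ge0.
Qed.

(** Given a compact [K] contained in [B] and a compact [Z] of almost full
    measure, [W := (Z `&` F) `|` K] and [(Z `\` G) `|` K], for [G] a tight
    neighbourhood of [W], are compact subsets of [B `|` F] and
    [B `|` ~` F]. *)
Let iota_closed (B F : set T) : closed F ->
  1 + iota B <= iota (B `|` F) + iota (B `|` ~` F).
Proof.
move=> cF; apply/ler_addgt0Pr => e e0; have e30 : 0 < e / 3 by lra.
have [K [cK KB iK]] := iota_approx B e30.
have [Z [cZ _]] := iota_approx setT e30; rewrite iotaT => iZ.
pose W := (Z `&` F) `|` K.
have cW : compact W by apply: compactU => //; exact: compact_closedI.
have [G [gG WG lG]] := kap_approx W e30.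
pose V := Z `\` G.
have cV : compact V by apply: compact_setD => //; exact: GGopen.
have cVK : compact (V `|` K) by exact: compactU.
have VW : V `&` W = set0.
  by apply/seteqP; split=> // x [[_ nGx] /WG].
have kZ : kap Z <= kap V + lam G.
  apply/ler_addgt0Pr => f f0; have [H [gH VH lH]] := kap_approx V f0.
  have ZHG : Z `<=` H `|` G.
    by move=> x Zx; have [|nGx] := pselect (G x); [right|left; apply: VH].
  have := kap_le (GGU gH gG) ZHG; have := lamUI gH gG.
  have := lam_ge0 (GGI gH gG); lra.
have WBF : W `<=` B `|` F by move=> x [[_ Fx]|/KB]; [right|left].
have VBF : V `|` K `<=` B `|` ~` F.
  move=> x [[Zx nGx]|/KB]; last by left.
  by right => Fx; apply: nGx; apply: WG; left.
have := iota_ge cW WBF; have := iota_ge cVK VBF.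
have := kap_submodular (V `|` K) W.
have : kap K <= kap ((V `|` K) `&` W) by apply: le_kap => x Kx; split; right.
have : kap (V `|` W) <= kap ((V `|` K) `|` W).
  by apply: le_kap => x [Vx|Wx]; [left; left|right].
have := kap_supermodular cV cW; rewrite VW kap0.
lra.
Qed.

(** By [iota_closed] the closed sets are Caratheodory measurable, so [mstar] is
    a measure on the Borel sets. There it agrees with the inner measure [iota],
    which makes it Radon. *)
Lemma radon_of_content : exists m : radon_probability R T,
  forall G, GG G -> (m G <= (lam G)%:E)%E.
Proof.
pose om : {outer_measure set T -> \bar R} := HB.pack mstar
  (isOuterMeasure.Build R T mstar mstar0 mstar_ge0 le_mstar
     mstar_sigma_subadditive).
have cara_closed F : closed F -> om.-caratheodory F.
  move=> cF; apply: le_caratheodory_measurable => X.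
  rewrite /om /= /mstar -EFinD lee_fin !setCI setCK.
  have := iota_closed (~` X) cF; lra.
have borel_cara : (@measurable _ (borel T)) `<=` om.-cara.-measurable.
  apply: smallest_sub.
    split=> [|X mX|u_ mu_]; first exact: (@measurable0 _ (caratheodory_type om)).
      by rewrite setTD; exact: (@measurableC _ (caratheodory_type om)).
    exact: (@bigcupT_measurable _ (caratheodory_type om)).
  move=> A oA; rewrite -(setCK A); apply: measurableC.
  by apply: cara_closed; exact: open_closedC.
pose m0 : set (borel T) -> \bar R := mstar.
have m0_sigma : semi_sigma_additive m0.
  move=> F mF tF mUF.
  have h := @caratheodory_measure_sigma_additive R T om F.
  exact: (h (fun i => borel_cara _ (mF i)) tF (borel_cara _ mUF)).
pose m1 : {measure set (borel T) -> \bar R} := HB.pack m0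
  (isMeasure.Build _ _ _ m0 mstar0 mstar_ge0 m0_sigma).
have m1T : m1 setT = 1%E by rewrite /m1 /= /m0 /mstar setCT iota0 subr0.
pose m2 : probability (borel T) R := HB.pack m0
  (isMeasure.Build _ _ _ m0 mstar0 mstar_ge0 m0_sigma)
  (Measure_isProbability.Build _ _ _ m1 m1T).
have m2E B : borel_set B -> m2 B = (iota B)%:E.
  move=> mB; have := probability_setC m2 (measurableC mB); rewrite setCK => ->.
  by rewrite /m2 /= /m0 /mstar setCK -EFinB opprB addrC subrK.
have rm2 : radon m2.
  move=> B mB; rewrite m2E//; apply/eqP; rewrite eq_le; apply/andP; split.
    apply/lee_addgt0Pr => e e0.
    have [K [cK KB iK]] := iota_approx B e0.
    apply: (@le_trans _ _ (m2 K + e%:E)%E).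
      rewrite m2E; last exact: borel_compact.
      by rewrite -EFinD lee_fin (iota_compact cK); lra.
    by apply: leeD => //; apply: ereal_sup_ubound; exists K.
  apply: ge_ereal_sup => _ [K [KB cK] <-].
  rewrite m2E; last exact: borel_compact.
  by rewrite lee_fin le_iota.
have [m mE] := radon_probability_of hT rm2.
exists m => G gG.
have bG : borel_set G by apply: sub_sigma_algebra; exact: GGopen.
rewrite mE// m2E// lee_fin; apply: iota_le => K _; exact: kap_le.
Qed.

End content_extension.

(** * Bounded measurable functions *)

Section bounded_measurable.
Context {d : measure_display} {T : measurableType d} {R : realType}.
Implicit Types f g : T -> R.

Definition bounded_measurable f :=
  measurable_fun setT f /\ exists M, forall x, `|f x| <= M.

Lemma bounded_measurable_cst c : bounded_measurable (fun=> c).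
Proof. by split; [exact: measurable_cst|exists `|c|]. Qed.

Lemma bounded_measurableD f g : bounded_measurable f -> bounded_measurable g ->
  bounded_measurable (fun x => f x + g x).
Proof.
move=> [mf [M fM]] [mg [N gN]]; split; first exact: measurable_funD.
by exists (M + N) => x; rewrite (le_trans (ler_normD _ _))// lerD.
Qed.

Lemma bounded_measurableM f g : bounded_measurable f -> bounded_measurable g ->
  bounded_measurable (fun x => f x * g x).
Proof.
move=> [mf [M fM]] [mg [N gN]]; split; first exact: measurable_funM.
by exists (M * N) => x; rewrite normrM ler_pM.
Qed.

Lemma bounded_measurableB f g : bounded_measurable f -> bounded_measurable g ->
  bounded_measurable (fun x => f x - g x).
Proof.
move=> bf bg; rewrite (_ : (fun _ => _) = (fun x => f x + -1 * g x)); last first.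
  by apply/funext => x; rewrite mulN1r.
apply: bounded_measurableD => //; apply: bounded_measurableM => //.
exact: bounded_measurable_cst.
Qed.

Lemma bounded_measurable_indic A : measurable A ->
  bounded_measurable (fun x => \1_A x).
Proof.
move=> mA; split; first exact: measurable_indic.
by exists 1 => x; rewrite indicE; case: (_ \in _); rewrite ?normr1 ?normr0.
Qed.

Lemma bounded_measurable_sum (I : Type) (s : seq I) (F : I -> T -> R) :
  (forall i, bounded_measurable (F i)) ->
  bounded_measurable (fun x => \sum_(i <- s) F i x).
Proof.
move=> bF; elim: s => [|i s IH].
  by under eq_fun do rewrite big_nil; exact: bounded_measurable_cst.
by under eq_fun do rewrite big_cons; exact: bounded_measurableD.
Qed.

Lemma bounded_measurable_prod (I : Type) (s : seq I) (F : I -> T -> R) :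
  (forall i, bounded_measurable (F i)) ->
  bounded_measurable (fun x => \prod_(i <- s) F i x).
Proof.
move=> bF; elim: s => [|i s IH].
  by under eq_fun do rewrite big_nil; exact: bounded_measurable_cst.
by under eq_fun do rewrite big_cons; exact: bounded_measurableM.
Qed.

Variable mu : probability T R.

Lemma bounded_measurable_integrable f : bounded_measurable f ->
  mu.-integrable setT (EFin \o f).
Proof.
move=> [mf [M fM]]; apply: measurable_bounded_integrable => //.
  by rewrite ltey_eq fin_num_measure.
exists M; split; first by rewrite num_real.
by move=> N MN x _ /=; apply: le_trans (fM x) _; exact: ltW.
Qed.

Lemma bounded_measurable_integralE f : bounded_measurable f ->
  (\int[mu]_x (f x)%:E)%E = (\int[mu]_x f x)%:E.
Proof.
by move=> bf; rewrite fineK//; apply/integrable_fin_num => //;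
  exact: bounded_measurable_integrable.
Qed.

Lemma expectD f g : bounded_measurable f -> bounded_measurable g ->
  \int[mu]_x (f x + g x) = \int[mu]_x f x + \int[mu]_x g x.
Proof.
by move=> bf bg; apply: RintegralD => //; exact: bounded_measurable_integrable.
Qed.

Lemma expectB f g : bounded_measurable f -> bounded_measurable g ->
  \int[mu]_x (f x - g x) = \int[mu]_x f x - \int[mu]_x g x.
Proof.
by move=> bf bg; apply: RintegralB => //; exact: bounded_measurable_integrable.
Qed.

Lemma expectZ c f : bounded_measurable f ->
  \int[mu]_x (c * f x) = c * \int[mu]_x f x.
Proof.
by move=> bf; apply: RintegralZl => //; exact: bounded_measurable_integrable.
Qed.

Lemma expect_cst c : \int[mu]_x c = c.
Proof.
transitivity (c * fine (mu setT)); first exact: Rintegral_cst.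
by rewrite probability_setT mulr1.
Qed.

Lemma le_expect f g : bounded_measurable f -> bounded_measurable g ->
  (forall x, f x <= g x) -> \int[mu]_x f x <= \int[mu]_x g x.
Proof.
move=> bf bg fg.
by apply: le_Rintegral => //; exact: bounded_measurable_integrable.
Qed.

Lemma expect_indic A : measurable A -> \int[mu]_x \1_A x = fine (mu A).
Proof. by move=> mA; rewrite /Rintegral integral_indic// setIT. Qed.

Lemma expect_sum (I : Type) (s : seq I) (F : I -> T -> R) :
  (forall i, bounded_measurable (F i)) ->
  \int[mu]_x (\sum_(i <- s) F i x) = \sum_(i <- s) \int[mu]_x F i x.
Proof.
move=> bF; elim: s => [|i s IH].
  rewrite big_nil -[RHS](expect_cst 0).
  by apply: eq_Rintegral => x _; rewrite big_nil.
rewrite big_cons -IH -expectD//; last exact: bounded_measurable_sum.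
by apply: eq_Rintegral => x _; rewrite big_cons.
Qed.

Lemma expect_cvg (f_ : nat -> T -> R) f (M : R) :
  (forall n, bounded_measurable (f_ n)) -> bounded_measurable f ->
  (forall n x, `|f_ n x| <= M) -> (forall x, f_^~ x @ \oo --> f x) ->
  (\int[mu]_x f_ n x) @[n --> \oo] --> \int[mu]_x f x.
Proof.
move=> bf_ bf fM ff.
have := @dominated_cvg _ T R mu setT measurableT (fun n x => (f_ n x)%:E)
  (EFin \o f) (cst M%:E).
rewrite /= bounded_measurable_integralE// => h.
have h2 : (\int[mu]_x (f_ n x)%:E)%E @[n --> \oo] --> (\int[mu]_x f x)%:E.
  apply: h => //.
  - by move=> n; apply/measurable_EFinP; case: (bf_ n).
  - by move=> x _; apply/fine_cvgP; split; [exact: nearW|exact: ff].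
  - exact: bounded_measurable_integrable (bounded_measurable_cst M).
  - by move=> n x _; rewrite lee_fin.
by move/fine_cvg : h2.
Qed.

Lemma fine_probability_ge0 A : 0 <= fine (mu A).
Proof. exact: fine_ge0. Qed.

Lemma fine_probability_le1 A : measurable A -> fine (mu A) <= 1.
Proof.
by move=> mA; rewrite -lee_fin fineK ?fin_num_measure// probability_le1.
Qed.

Lemma fine_probabilityC A : measurable A -> fine (mu (~` A)) = 1 - fine (mu A).
Proof.
by move=> mA; rewrite probability_setC// fineB// fin_num_measure.
Qed.

Lemma le_fine_probability A B : measurable A -> measurable B -> A `<=` B ->
  fine (mu A) <= fine (mu B).
Proof.
move=> mA mB AB; apply: fine_le; rewrite ?fin_num_measure//.
by apply: le_measure; rewrite ?inE.
Qed.

Lemma fine_probabilityUI A B : measurable A -> measurable B ->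
  fine (mu (A `|` B)) + fine (mu (A `&` B)) = fine (mu A) + fine (mu B).
Proof.
move=> mA mB; rewrite -!expect_indic//; [|exact: measurableI|exact: measurableU].
rewrite -!expectD; try by apply: bounded_measurable_indic;
  do ?[exact: measurableI|exact: measurableU].
apply: eq_Rintegral => x _; rewrite !indicE in_setU in_setI.
by case: (_ \in A); case: (_ \in B); rewrite /= ?addr0 ?add0r.
Qed.

Let count_step (N : nat) (y : R) : 0 <= y ->
  let c := \sum_(j < N) ((j.+1%:R < y)%R%:R : R) in
  [/\ c <= y, c <= N%:R, N%:R < y -> c = N%:R & y <= N.+1%:R -> y <= 1 + c].
Proof.
move=> y0 /=; elim: N => [|N [IH1 IH2 IH3 IH4]].
  by rewrite !big_ord0; split => // y1; rewrite addr0.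
rewrite big_ord_recr/=; set c := \sum_(_ < _) _ in IH1 IH2 IH3 IH4 *.
have E : N.+1%:R = 1 + N%:R :> R by rewrite -natr1 addrC.
have E' : N.+2%:R = 1 + N.+1%:R :> R by rewrite -natr1 addrC.
rewrite E' E in IH4 *; have [yN|yN] /= := ltP (1 + N%:R) y.
  have {}IH3 := IH3 (ltac:(lra)); split; lra.
by have {}IH4 := IH4 yN; split; lra.
Qed.

(** A function with values in [[0, 1]] is within [1 / N] of the average of the
    indicators of [N] of its superlevel sets, so inequalities between the
    measures of superlevel sets pass to integrals. *)
Lemma layer_cake f N : bounded_measurable f -> (forall x, 0 <= f x <= 1) ->
  let L := N.+1%:R^-1 *
    \sum_(j < N.+1) fine (mu [set x | j.+1%:R / N.+1%:R < f x]) in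
  L <= \int[mu]_x f x <= L + N.+1%:R^-1.
Proof.
move=> bf f01 /=.
have N0 : 0 < N.+1%:R :> R by [].
pose A (j : 'I_N.+1) := [set x | j.+1%:R / N.+1%:R < f x].
have mA j : measurable (A j).
  rewrite [A j](_ : _ = f @^-1` `]j.+1%:R / N.+1%:R, +oo[); last first.
    by apply/seteqP; split => x /=; rewrite in_itv/= andbT.
  by rewrite -[X in measurable X]setTI; apply: bf.1.
pose g x := N.+1%:R^-1 * \sum_(j < N.+1) \1_(A j) x : R.
have bs : bounded_measurable (fun x => \sum_(j < N.+1) \1_(A j) x : R).
  by apply: bounded_measurable_sum => j; exact: bounded_measurable_indic.
have bg : bounded_measurable g.
  by apply: bounded_measurableM => //; exact: bounded_measurable_cst.
have gE : N.+1%:R^-1 * \sum_(j < N.+1) fine (mu (A j)) = \int[mu]_x g x.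
  rewrite expectZ// expect_sum; last by move=> j; exact: bounded_measurable_indic.
  by congr (_ * _); apply: eq_bigr => j _; rewrite expect_indic.
have gf x : g x <= f x /\ f x <= g x + N.+1%:R^-1.
  have /andP[fx0 fx1] := f01 x.
  have [] := @count_step N.+1 (N.+1%:R * f x); first by rewrite mulr_ge0.
  set c := \sum_(_ < _) _.
  have -> : c = \sum_(j < N.+1) \1_(A j) x.
    apply: eq_bigr => j _; rewrite indicE.
    rewrite (_ : (x \in A j) = (j.+1%:R / N.+1%:R < f x)); last first.
      by apply/idP/idP; rewrite inE.
    by rewrite ltr_pdivrMr// [f x * _]mulrC.
  set s := \sum_(_ < _) _ => h1 _ _ h2; split.
    by rewrite /g -/s mulrC ler_pdivrMr// mulrC.
  have : N.+1%:R * f x <= 1 + s.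
    by apply: h2; apply: (@le_trans _ _ N.+1%:R); rewrite ?ler_piMr// ler_nat.
  rewrite mulrC -ler_pdivlMr// => /le_trans; apply.
  by rewrite /g -/s mulrDl mul1r addrC mulrC.
rewrite gE; apply/andP; split.
  by apply: le_expect => // x; case: (gf x).
rewrite -[X in _ + X]expect_cst -expectD//; last exact: bounded_measurable_cst.
apply: le_expect => //; last by move=> x; case: (gf x).
by apply: bounded_measurableD => //; exact: bounded_measurable_cst.
Qed.

End bounded_measurable.

(** * The A-topology *)

Section A_topology.
Context {R : realType} {S : ptopologicalType}.
Notation T := (radon_probability R S).

Lemma borel_open (G : set S) : open G -> borel_set G.
Proof. exact: sub_sigma_algebra. Qed.

Lemma borelC (B : set S) : borel_set B -> borel_set (~` B).
Proof. exact: (@measurableC _ (borel S)). Qed.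

Lemma open_A_subbase (f : S -> R) (a : R) : bounded_fun f ->
  upper_semicontinuous (EFin \o f) ->
  open [set mu : T | (\int[mu]_x (f x)%:E < a%:E)%E].
Proof.
move=> bf uf; exists [set [set mu : T | (\int[mu]_x (f x)%:E < a%:E)%E]].
  move=> _ ->; exists [fset (f, a)]%fset; last first.
    by rewrite set_fset1 bigcap_set1.
  by move=> i; rewrite in_fset1 => /eqP ->; exact/mem_set.
by rewrite bigcup_set1.
Qed.

Lemma A_cvg_subbase (F : set_system T) (mu0 : T) : Filter F ->
  (forall (f : S -> R) a, bounded_fun f -> upper_semicontinuous (EFin \o f) ->
    (\int[mu0]_x (f x)%:E < a%:E)%E ->
    F [set mu : T | (\int[mu]_x (f x)%:E < a%:E)%E]) ->
  F --> mu0.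
Proof.
move=> FF h A; rewrite nbhsE => -[B [[D sD <-] [i Di imu0]] BA].
apply: filterS BA _.
have [D' sD' D'E] := sD _ Di.
apply: (@filterS _ F _ i); first by move=> x ix; exists i.
rewrite -D'E; apply: filter_bigI => -[f a] faD'.
have /set_mem[/= bf uf] := sD' _ faD'; apply: h => //.
by move: imu0; rewrite -D'E => /(_ _ faD').
Qed.

Lemma open_eval_gt (G : set S) (a : R) : open G ->
  open [set mu : T | a < fine (mu G)].
Proof.
move=> oG; have mG : measurable (G : set (borel S)) by exact: borel_open.
pose f x : R := - \1_G x.
rewrite (_ : [set _ | _] =
    [set mu : T | (\int[mu]_x (f x)%:E < (- a)%:E)%E]); last first.
  apply/seteqP; split=> mu /=;
  rewrite (_ : \int[mu]_x (f x)%:E = (- fine (mu G))%:E)%E ?lte_fin ?ltrN2//;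
  rewrite /f; under eq_integral do rewrite EFinN;
  by rewrite integral_ge0N// integral_indic// setIT EFinN fineK// fin_num_measure.
apply: open_A_subbase.
  exists 1; split; first by rewrite num_real.
  move=> M M1 x _ /=; rewrite /f normrN indicE.
  by case: (_ \in _); rewrite ?normr1 ?normr0; lra.
move=> x b; rewrite /f /= lte_fin indicE.
have [xG|xG] := boolP (x \in G) => fxb.
  exists G; first by apply: open_nbhs_nbhs; split => //; rewrite inE in xG.
  by move=> y Gy; rewrite lte_fin indicE mem_set.
exists setT; first exact: filterT.
move=> y _; rewrite lte_fin indicE; apply: le_lt_trans fxb.
by rewrite lerN2 ler_nat.
Qed.

(** Integrals of bounded semicontinuous functions are approximated through
    [layer_cake] by the measures of finitely many open sets, so the open sets
    alone control convergence. *)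
Lemma A_cvg (F : set_system T) (mu0 : T) : Filter F ->
  (forall G a, open G -> a < fine (mu0 G) -> F [set mu : T | a < fine (mu G)]) ->
  F --> mu0.
Proof.
move=> FF h; apply: A_cvg_subbase => f a [M0 [_ bf]] uf fa.
have {bf}[M M0' bf] : exists2 M : R, 0 < M & forall x, `|f x| <= M.
  exists (`|M0| + 1); first by rewrite ltr_wpDl.
  by move=> x; apply: bf => //; rewrite (le_lt_trans (ler_norm _))// ltrDl.
have M20 : 0 < 2 * M by lra.
(* [f] is rescaled to [[0, 1]] and reversed, so that the superlevel sets of [g]
   are open. *)
pose g x : R := (M - f x) / (2 * M).
have g01 x : 0 <= g x <= 1.
  have := bf x; rewrite ler_norml => /andP[? ?].
  apply/andP; split; first by apply: divr_ge0; lra.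
  by rewrite ler_pdivrMr//; lra.
have og t : open [set x | t < g x].
  move/upper_semicontinuousP : uf => /(_ (M - t * (2 * M))).
  congr open; apply/seteqP; split => x /=; rewrite lte_fin /g ltr_pdivlMr//; lra.
have bmg : bounded_measurable (g : borel S -> R).
  split; last by exists 1 => x; have /andP[? ?] := g01 x; rewrite ger0_norm.
  move=> _; apply: (measurability _ (RGenOInfty.measurableE R)) => //.
  move=> /= _ [_ [t ->] <-]; rewrite setTI preimage_itvoy.
  exact: borel_open (og t).
have fE x : f x = M - 2 * M * g x.
  by rewrite /g mulrCA divff ?mulr1 ?lt0r_neq0// opprB addrC subrK.
have fint (mu : T) : (\int[mu]_x (f x)%:E)%E = (M - 2 * M * \int[mu]_x g x)%:E.
  have bmc := @bounded_measurable_cst _ (borel S) R.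
  have bm2 : bounded_measurable (fun x : borel S => 2 * M * g x).
    exact: bounded_measurableM.
  transitivity (\int[mu]_x (M - 2 * M * g x)%:E)%E.
    by apply: eq_integral => x _; rewrite fE.
  rewrite bounded_measurable_integralE; last exact: bounded_measurableB.
  by rewrite expectB// expect_cst expectZ.
pose c := (M - a) / (2 * M).
have fltE (mu : T) : (\int[mu]_x (f x)%:E < a%:E)%E = (c < \int[mu]_x g x).
  by rewrite fint lte_fin /c ltr_pdivrMr//; apply/idP/idP; lra.
rewrite fltE in fa.
rewrite (_ : mkset _ = [set mu : T | c < \int[mu]_x g x]); last first.
  by apply/seteqP; split => mu /=; rewrite fltE.
have [N hN] : exists N, c + N.+1%:R^-1 < \int[mu0]_x g x.
  by have [N hN] := ltr_add_invr fa; exists N.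
pose A (j : 'I_N.+1) := [set x | j.+1%:R / N.+1%:R < g x].
have /andP[_ up] := layer_cake mu0 N bmg g01.
pose s0 := N.+1%:R^-1 * \sum_(j < N.+1) fine (mu0 (A j)).
have {}up : \int[mu0]_x g x <= s0 + N.+1%:R^-1 := up.
have cs0 : c < s0 by rewrite -(ltrD2r N.+1%:R^-1); exact: lt_le_trans hN up.
pose eta := (s0 - c) / 2.
have : F [set mu : T | forall j, fine (mu0 (A j)) - eta < fine (mu (A j))].
  apply: filter_forall => j; apply: h; first exact: og.
  by rewrite /eta; lra.
apply: filterS => mu /= muA.
have /andP[low _] := layer_cake mu N bmg g01.
apply: lt_le_trans low.
have N0 : 0 < N.+1%:R :> R by [].
have : \sum_(j < N.+1) (fine (mu0 (A j)) - eta) <= \sum_(j < N.+1) fine (mu (A j)).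
  by apply: ler_sum => j _; exact: ltW.
rewrite sumrB sumr_const card_ord -[eta *+ _]mulr_natl.
rewrite -(ler_pM2l (_ : 0 < N.+1%:R^-1)) ?invr_gt0//.
move=> h1; apply: lt_le_trans h1; rewrite mulrBr -/s0 mulKf ?lt0r_neq0//.
by rewrite /eta; lra.
Qed.

(** The finite intersections of sets [mu G > a] with [G] open form a
    neighbourhood base; stated as an induction principle, this avoids indexing
    the intersections. *)
Lemma A_nbhs_ind (P : set T -> Prop) (mu0 : T) : P setT ->
  (forall A B, P A -> P B -> P (A `&` B)) ->
  (forall G a, open G -> a < fine (mu0 G) -> P [set mu : T | a < fine (mu G)]) ->
  forall A, nbhs mu0 A -> exists2 B, P B & B `<=` A.
Proof.
move=> PT PI Popen; pose F := [set A | exists2 B, P B & B `<=` A].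
have FF : Filter F.
  split; first by exists setT.
  - move=> A B [A' PA' A'A] [B' PB' B'B]; exists (A' `&` B'); first exact: PI.
    exact: setISS.
  - by move=> A B AB [A' PA' A'A]; exists A' => //; exact: subset_trans AB.
apply: (@A_cvg F mu0 FF) => G a oG aG; exists [set mu : T | a < fine (mu G)] => //.
exact: Popen.
Qed.

End A_topology.

(** * Inner regularity and ultrafilter limits *)

Section radon_approximation.
Context {R : realType} {S : ptopologicalType} (hS : hausdorff_space S).

Lemma radon_inner (mu : probability (borel S) R) (B : set S) (e : R) :
  radon mu -> borel_set B -> 0 < e ->
  exists K : set S, [/\ compact K, K `<=` B & fine (mu B) - e < fine (mu K)].
Proof.
move=> rmu mB e0; have fB := fin_num_measure mu B mB.
have : ((fine (mu B) - e)%:E < mu B)%E.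
  by rewrite -[ltRHS]fineK// lte_fin ltrBlDr ltrDl.
rewrite {2}(rmu _ mB) => /ereal_sup_gt[_ [K [KB cK] <-] eK].
have mK := borel_compact hS cK; have fK := fin_num_measure mu K mK.
by exists K; split => //; rewrite -lte_fin fineK.
Qed.

Lemma radon_outer (mu : probability (borel S) R) (B : set S) (e : R) :
  radon mu -> borel_set B -> 0 < e ->
  exists G : set S, [/\ open G, B `<=` G & fine (mu G) < fine (mu B) + e].
Proof.
move=> rmu mB e0; have mBC := borelC mB.
have [K [cK KB]] := radon_inner rmu mBC e0.
have mK := borel_compact hS cK.
rewrite !fine_probabilityC// => eK; exists (~` K); split.
- exact/closed_openC/(compact_closed hS).
- by move=> x Bx Kx; exact: KB Kx Bx.
- by rewrite fine_probabilityC//; lra.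
Qed.

(** The inequality on compact sets passes to all Borel sets by inner regularity,
    and complements reverse it. *)
Lemma radon_probability_le_compact_eq (mu nu : radon_probability R S) :
  (forall K : set S, compact K -> fine (mu K) <= fine (nu K)) -> mu = nu.
Proof.
move=> le_munu.
have le_borel (B : set S) : borel_set B -> fine (mu B) <= fine (nu B).
  move=> mB; apply/ler_addgt0Pr => e e0.
  have [K [cK KB eK]] := radon_inner (radon_probability_radon mu) mB e0.
  have mK := borel_compact hS cK.
  have := le_munu K cK; have := le_fine_probability nu mK mB KB.
  by move: eK; lra.
apply: radon_probability_eq => B mB.
have fmu := fin_num_measure mu B mB; have fnu := fin_num_measure nu B mB.
rewrite -(fineK fmu) -(fineK fnu); congr EFin; apply/eqP.
rewrite eq_le le_borel//=; have := le_borel _ (borelC mB).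
by rewrite !fine_probabilityC// lerD2l lerN2.
Qed.

(** Two Radon measures that differ do so on some compact [K], and [K] and a
    large compact part of its complement have disjoint neighbourhoods. *)
Lemma A_hausdorff : hausdorff_space (radon_probability R S).
Proof.
move=> mu nu clmunu; apply/esym/radon_probability_le_compact_eq => K cK.
rewrite leNgt; apply/negP => munuK.
have mK := borel_compact hS cK; have mKC := borelC mK.
pose e := (fine (nu K) - fine (mu K)) / 2.
have e0 : 0 < e by rewrite /e; lra.
have [L [cL LK]] := radon_inner (radon_probability_radon mu) mKC e0.
rewrite fine_probabilityC// => eL; have mL := borel_compact hS cL.
have KL : K `&` L = set0 by apply/seteqP; split => // x [Kx /LK].
have base (x : S) O : open O -> O x -> exists G, [/\ open G, G x & G `<=` O].
  by move=> oO Ox; exists O; split.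
have [U [V [oU oV KU LV UV]]] := @compact_base_separation S hS open
    (fun _ h => h) open0 (@openU S) (@openI S) base K L cK cL KL.
pose c := fine (mu K) + e.
have nuU : nbhs nu [set rho : radon_probability R S | c < fine (rho U)].
  apply: open_nbhs_nbhs; split; first exact: open_eval_gt.
  have := le_fine_probability nu mK (borel_open oU) KU.
  by rewrite /= /c; apply: lt_le_trans; rewrite /e; lra.
have muV : nbhs mu [set rho : radon_probability R S | 1 - c < fine (rho V)].
  apply: open_nbhs_nbhs; split; first exact: open_eval_gt.
  have := le_fine_probability mu mL (borel_open oV) LV.
  by rewrite /= /c; apply: lt_le_trans; lra.
have [rho [/= rhoV rhoU]] := clmunu _ _ muV nuU.
have := le_fine_probability rho (borel_open oV) (borelC (borel_open oU)).
rewrite fine_probabilityC; last exact: borel_open.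
have VU : V `<=` ~` U by move=> x Vx Ux; have : (U `&` V) x by []; rewrite UV.
by move=> /(_ VU); lra.
Qed.

End radon_approximation.

Section ultralimit.
Context {R : realType} {I : Type} (F : set_system I).
Hypothesis FU : UltraFilter F.

Let FF : Filter F.
Proof. exact: filter_filter. Qed.

Lemma ultra_cvg (u : I -> R) : (forall i, 0 <= u i <= 1) -> cvg (u @ F).
Proof.
move=> u01; have uF : ProperFilter (u @ F) by exact: fmap_proper_filter.
have [|c [_ cc]] := @segment_compact R 0 1 (u @ F) uF.
  by apply: (@filterS _ F _ setT); [move=> i _ /=; rewrite in_itv/=|exact: filterT].
apply/cvg_ex; exists c => A cA.
have [//|FA] := in_ultra_setVsetC (u @^-1` A) FU.
by have [|x [nAx Ax]] := cc (~` A) A _ cA.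
Qed.

Lemma ultra_not (A : set I) : ~ F (~` A) -> F A.
Proof. by move=> nF; have [] := in_ultra_setVsetC A FU. Qed.

Lemma ultra_lim_le (u v : I -> R) : (forall i, 0 <= u i <= 1) ->
  (forall i, 0 <= v i <= 1) -> (forall i, u i <= v i) ->
  lim (u @ F) <= lim (v @ F).
Proof.
move=> u01 v01 uv; rewrite -subr_ge0.
have cvu := @cvgB _ _ _ F FF _ _ _ _ (ultra_cvg v01) (ultra_cvg u01).
rewrite -(cvg_lim (@Rhausdorff R) cvu); apply: limr_ge.
  by apply/cvg_ex; eexists; exact: cvu.
by apply: nearW => i; rewrite fctE subr_ge0.
Qed.

Context {T : ptopologicalType} (hT : hausdorff_space T) (GG : set (set T)).
Hypothesis GGopen : forall G, GG G -> open G.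
Hypothesis GG0 : GG set0.
Hypothesis GGT : GG setT.
Hypothesis GGU : forall G H, GG G -> GG H -> GG (G `|` H).
Hypothesis GGI : forall G H, GG G -> GG H -> GG (G `&` H).
Hypothesis GGbase : forall x O, open O -> O x ->
  exists G, [/\ GG G, G x & G `<=` O].
Variable m : I -> set T -> R.
Hypothesis m0 : forall i, m i set0 = 0.
Hypothesis mT : forall i, m i setT = 1.
Hypothesis le_m : forall i G H, GG G -> GG H -> G `<=` H -> m i G <= m i H.
Hypothesis mUI : forall i G H, GG G -> GG H ->
  m i (G `|` H) + m i (G `&` H) = m i G + m i H.
Hypothesis m_tight : forall e : R, 0 < e ->
  exists K, compact K /\ forall G, GG G -> K `<=` G -> F [set i | 1 - e <= m i G].

(** Bounded set functions converge along an ultrafilter, and the limit of tight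
    contents is a tight content.  The Radon measure that it induces may put less
    mass on an open set than the limit does, as in the portmanteau theorem,
    which is why the conclusion is one-sided. *)
Lemma radon_of_ultralimit : exists mu : radon_probability R T,
  forall G (c : R), GG G -> c < fine (mu G) -> F [set i | c < m i G].
Proof.
have m01 G : GG G -> forall i, 0 <= m i G <= 1.
  by move=> gG i; rewrite -(m0 i) -(mT i) !le_m.
pose lam G := lim ((m^~ G) @ F).
have lam_cst G (c : R) : (forall i, m i G = c) -> lam G = c.
  move=> mc; rewrite /lam (_ : m^~ G = cst c); last exact/funext.
  by apply: lim_cst; exact: Rhausdorff.
have lamUI G H : GG G -> GG H -> lam (G `|` H) + lam (G `&` H) = lam G + lam H.
  move=> gG gH.
  have c1 := @cvgD _ _ _ F FF _ _ _ _ (ultra_cvg (m01 _ (GGU gG gH)))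
    (ultra_cvg (m01 _ (GGI gG gH))).
  have c2 := @cvgD _ _ _ F FF _ _ _ _ (ultra_cvg (m01 _ gG))
    (ultra_cvg (m01 _ gH)).
  rewrite /lam -(cvg_lim (@Rhausdorff R) c1) -(cvg_lim (@Rhausdorff R) c2).
  by congr (lim (_ @ F)); apply/funext => i; rewrite !fctE mUI.
have lam_tight (e : R) : 0 < e -> exists K, compact K /\
    forall G, GG G -> K `<=` G -> 1 - e <= lam G.
  move=> e0; have [K [cK hK]] := m_tight e0; exists K; split => // G gG KG.
  by apply: limr_ge; [exact: ultra_cvg (m01 _ gG)|exact: hK].
have [mu hmu] := @radon_of_content R T hT GG lam GGopen GG0 GGT GGU GGI GGbase
  (lam_cst _ _ m0) (lam_cst _ _ mT)
  (fun G H gG gH GH => ultra_lim_le (m01 _ gG) (m01 _ gH)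
     (fun i => le_m i gG gH GH)) lamUI lam_tight.
exists mu => G c gG cG; apply: ultra_not => FC.
  have := hmu G gG; have mG : measurable (G : set (borel T)).
    by apply: borel_open; exact: GGopen.
  rewrite -[leLHS]fineK ?fin_num_measure// lee_fin leNgt => /negP; apply.
  apply: le_lt_trans cG; apply: limr_le; first exact: ultra_cvg (m01 _ gG).
  by apply: filterS FC => i /= /negP; rewrite -leNgt.
Qed.

End ultralimit.

(** * Measurability of evaluations and compactness *)

Section A_measurable_compact.
Context {R : realType} {S : ptopologicalType} (hS : hausdorff_space S).
Notation T := (radon_probability R S).

(** On open sets evaluation is lower semicontinuous, and the sets with
    measurable evaluation form a Dynkin system. *)
Lemma measurable_eval (B : set S) : borel_set B ->
  measurable_fun setT (fun mu : borel T => (mu : T) B).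
Proof.
apply: (@dynkin_induction _ (borel S) open
  (fun B => measurable_fun setT (fun mu : borel T => (mu : T) B))) => //.
- exact: openI.
- rewrite (_ : (fun _ => _) = cst 1%E); first exact: measurable_cst.
  by apply/funext => mu; exact: probability_setT.
- move=> G oG; pose f (mu : borel T) : R := fine ((mu : T) G).
  rewrite (_ : (fun _ => _) = EFin \o f); last first.
    apply/funext => mu; rewrite /f /= fineK// fin_num_measure//.
    exact: borel_open.
  apply/measurable_EFinP => _.
  apply: (measurability _ (RGenOInfty.measurableE R)) => //.
  move=> /= _ [_ [a ->] <-]; rewrite setTI preimage_itvoy.
  exact: borel_open (open_eval_gt a oG).
- move=> C mC hC.
  rewrite (_ : (fun _ => _) = (fun mu : borel T => 1%E - (mu : T) C)%E); last first.
    by apply/funext => mu; rewrite probability_setC.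
  by apply: emeasurable_funB => //; exact: measurable_cst.
- move=> C mC tC hC.
  rewrite (_ : (fun _ => _) =
      (fun mu : borel T => \sum_(i <oo) (mu : T) (C i))%E); last first.
    apply/funext => mu; apply: measure_semi_bigcup => //.
    exact: bigcupT_measurable.
  exact: ge0_emeasurable_sum.
Qed.

Lemma bounded_measurable_eval (B : set S) : borel_set B ->
  bounded_measurable (fun mu : borel T => fine ((mu : T) B)).
Proof.
move=> mB; split.
  apply: measurableT_comp; last exact: measurable_eval.
  exact: fine_measurable.
exists 1 => mu; rewrite ger0_norm ?fine_probability_le1//.
exact: fine_probability_ge0.
Qed.

(** An ultrafilter on this uniformly tight family converges to the Radon measure
    that its limit on open sets induces, and the conditions on the open sets
    [~` K j] survive in the limit. *)
Lemma A_compact (K : nat -> set S) (eps : nat -> R) :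
  (forall j, compact (K j)) -> (forall e, 0 < e -> exists j, eps j <= e) ->
  compact [set mu : T | forall j, fine (mu (~` K j)) <= eps j].
Proof.
move=> cK heps; rewrite compact_ultra => F FU FA.
have mK j : borel_set (K j) by exact: borel_compact.
have [mu0 hmu0] : exists mu : radon_probability R S, forall G (c : R),
    open G -> c < fine (mu G) -> F [set nu : T | c < fine (nu G)].
  apply: (@radon_of_ultralimit R T F FU S hS open (fun _ h => h) open0 openT
    (@openU S) (@openI S) _ (fun (mu : T) G => fine (mu G))).
  - by move=> x O oO Ox; exists O; split.
  - by move=> mu; rewrite measure0.
  - by move=> mu; rewrite probability_setT.
  - move=> mu G H oG oH.
    exact: (le_fine_probability mu (borel_open oG) (borel_open oH)).
  - move=> mu G H oG oH.
    exact: (fine_probabilityUI mu (borel_open oG) (borel_open oH)).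
  - move=> e e0; have [j je] := heps e e0; exists (K j); split => // G oG KG.
    apply: filterS FA => mu /(_ j) /= muK.
    have := le_fine_probability mu (mK j) (borel_open oG) KG.
    by rewrite -[in X in X <= _](setCK (K j)) fine_probabilityC//; [lra|exact: borelC].
exists mu0; split; last by apply: A_cvg => G a; exact: hmu0.
move=> j /=; rewrite leNgt; apply/negP => epsj.
have oKC : open (~` K j) by exact/closed_openC/(compact_closed hS).
have := hmu0 _ _ oKC epsj => /(filterI FA)/filter_ex[nu [/(_ j)]] /= nuK.
by rewrite ltNge nuK.
Qed.

End A_measurable_compact.

(** * Exchangeability and injections *)

Section injections.

(** The values of [f], followed by the remaining indices, enumerate ['I_n]. *)
Lemma perm_of_injection (k n : nat) (f : 'I_k -> 'I_n) (kn : (k <= n)%N) :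
  injective f -> exists s : 'S_n, forall i, s (widen_ord kn i) = f i.
Proof.
case: n f kn => [|n] f kn fI.
  by exists 1%g => i; case: (f i).
pose t := codom f ++ [seq x <- enum 'I_n.+1 | x \notin codom f].
have ut : uniq t.
  rewrite cat_uniq filter_uniq ?enum_uniq// andbT map_inj_uniq// enum_uniq/=.
  by rewrite -all_predC; apply/allP => x; rewrite mem_filter => /andP[].
have tT x : x \in t.
  by rewrite mem_cat mem_filter mem_enum andbT orbN.
have st : size t = n.+1.
  by rewrite -[RHS](card_ord n.+1) -(card_uniqP ut); apply: eq_card => x; rewrite tT.
have nI : injective (fun i : 'I_n.+1 => nth ord0 t i).
  by move=> i j /eqP; rewrite nth_uniq ?st// => /eqP/val_inj.
exists (perm nI) => i; rewrite permE/= nth_cat size_codom card_ord ltn_ord.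
by rewrite (nth_map i) ?size_enum_ord// nth_ord_enum.
Qed.

(** A uniformly random map from [k] points to [N] points is injective with
    probability at least [1 - k ^ 2 / N]. *)
Lemma ffact_collision (R : realType) (N k : nat) : (0 < N)%N ->
  N%:R ^+ k * (1 - k%:R ^+ 2 / N%:R) <= (N ^_ k)%:R :> R.
Proof.
move=> N0; have N0' : 0 < N%:R :> R by rewrite ltr0n.
elim: k => [|k IH]; first by rewrite ffactn0 expr0 expr0n/= mul0r subr0 mulr1.
rewrite ffactnSr natrM exprSr.
have NkE : N%:R * (1 - k.+1%:R ^+ 2 / N%:R) = N%:R - k.+1%:R ^+ 2 :> R.
  by rewrite mulrBr mulr1 mulrCA divff ?mulr1// lt0r_neq0.
rewrite -mulrA NkE.
have Nk0 : 0 <= N%:R ^+ k :> R by rewrite exprn_ge0.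
have k0 : 0 <= k%:R :> R by [].
have [kN|Nk] := leqP k N; last first.
  apply: (@le_trans _ _ 0); last by rewrite mulr_ge0.
  rewrite mulr_ge0_le0// subr_le0.
  have : N%:R <= k%:R :> R by rewrite ler_nat ltnW.
  by rewrite -natr1; nra.
rewrite natrB//; apply: (le_trans _ (ler_wpM2r _ IH)); last first.
  by rewrite subr_ge0 ler_nat.
rewrite -mulrA ler_wpM2l// -natr1.
have -> : (1 - k%:R ^+ 2 / N%:R) * (N%:R - k%:R) =
    N%:R - k%:R - k%:R ^+ 2 + k%:R ^+ 3 / N%:R :> R.
  by field; rewrite lt0r_neq0.
have : 0 <= k%:R ^+ 3 / N%:R :> R by rewrite divr_ge0// exprn_ge0.
nra.
Qed.

End injections.

Section exchangeable_injection.
Context {R : realType} {d : measure_display} {Omega : measurableType d}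
  {d' : measure_display} {S : measurableType d'} (P : probability Omega R)
  (X : nat -> {RV P >-> S}).

Lemma measurable_rectangle (k : nat) (f : 'I_k -> nat) (B : 'I_k -> set S) :
  (forall i, measurable (B i)) ->
  measurable [set w | forall i, B i (X (f i) w)].
Proof.
move=> mB; rewrite (_ : [set _ | _] = \bigcap_(i : 'I_k) (X (f i) @^-1` B i)).
  apply: fin_bigcap_measurable => // i _; rewrite -[X in measurable X]setTI.
  exact: (measurable_funPT (X (f i))).
by apply/seteqP; split => w h i; [move=> _|]; exact: h.
Qed.

(** The injection is extended to a permutation of a larger initial segment, with
    the whole space as constraint at the additional indices. *)
Lemma exchangeable_injection (k : nat) (f : 'I_k -> nat) (B : 'I_k -> set S) :
  exchangeable P X -> injective f -> (forall i, measurable (B i)) ->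
  P [set w | forall i, B i (X (f i) w)] = P [set w | forall i : 'I_k, B i (X i w)].
Proof.
move=> hX fI mB; pose n := maxn k (\max_(i < k) (f i).+1).
have kn : (k <= n)%N by exact: leq_maxl.
have fn i : (f i < n)%N.
  by rewrite /n leq_max; apply/orP; right; exact: (leq_bigmax_cond i).
pose g i := Ordinal (fn i).
have gI : injective g by move=> i j /(congr1 val)/= /fI.
have [s hs] := perm_of_injection kn gI.
pose C (i : 'I_n) := if insub (val i) is Some j then B j else setT.
have Cw j : C (widen_ord kn j) = B j by rewrite /C /= valK.
have Cn (i : 'I_n) x : (forall j, i = widen_ord kn j -> B j x) -> C i x.
  move=> h; rewrite /C; case: insubP => // j _ ji; apply: h.
  exact/val_inj/esym.
have mC i : measurable (C i) by rewrite /C; case: insubP.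
have := hX n s C mC.
have -> : [set w | forall i : 'I_n, C i (X i w)] =
    [set w | forall i : 'I_k, B i (X i w)].
  apply/seteqP; split => w h i; first by have := h (widen_ord kn i); rewrite Cw.
  by apply: Cn => j ->; exact: h.
move=> ->; congr (P _); apply/seteqP; split => w h i.
  by apply: Cn => j ->; rewrite hs; exact: h.
by have := h (widen_ord kn i); rewrite Cw hs.
Qed.

End exchangeable_injection.

(** * Empirical measures *)

Section empirical_measure.
Context {R : realType} {S : ptopologicalType} (hS : hausdorff_space S).
Notation T := (radon_probability R S).

(** The uniform distribution on finitely many points is Radon because its mass
    sits on a finite, hence compact, set. *)
Lemma empirical_measure_exists (N : nat) (x : 'I_N.+1 -> S) :
  exists mu : T, forall B, borel_set B ->
    fine (mu B) = N.+1%:R^-1 * \sum_(i < N.+1) \1_B (x i).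
Proof.
have c0 : 0 <= N.+1%:R^-1 :> R by rewrite invr_ge0.
pose m := msum (fun k : nat => mscale (NngNum c0)
  (dirac (x (inord k) : borel S))) N.+1.
have mE (B : set (borel S)) : m B = (N.+1%:R^-1 * \sum_(i < N.+1) \1_B (x i))%:E.
  rewrite /m /msum mulr_sumr -sumEFin; apply: eq_bigr => i _.
  by rewrite /mscale /= /dirac /= inord_val EFinM.
have mT : m setT = 1%E.
  rewrite mE; under eq_bigr do rewrite indicT.
  by rewrite sumr_const card_ord mulVf.
have [p pE] : exists p : probability (borel S) R, forall B,
    p B = (N.+1%:R^-1 * \sum_(i < N.+1) \1_B (x i))%:E.
  pose p : probability (borel S) R := HB.pack (Measure.sort m)
    (Measure.on m) (Measure_isProbability.Build _ _ _ m mT).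
  by exists p => B; exact: mE.
have rp : radon p.
  move=> B mB; apply/eqP; rewrite eq_le; apply/andP; split.
    pose K := B `&` (x @` setT).
    apply: ereal_sup_ubound; exists K => /=.
      split; first exact: subIsetl.
      apply: finite_compact; apply: sub_finite_set (@subIsetr _ _ _) _.
      exact: finite_image.
    rewrite !pE; congr (_ * _)%:E; apply: eq_bigr => i _; rewrite !indicE in_setI.
    by rewrite [x i \in range x]mem_set ?andbT//; exists i.
  apply: ge_ereal_sup => _ [K [KB cK] <-]; apply: le_measure; rewrite ?inE//.
  exact: borel_compact.
have [mu muE] := radon_probability_of hS rp.
by exists mu => B mB; rewrite muE// pE.
Qed.

Definition empirical_measure (N : nat) (x : 'I_N.+1 -> S) : T :=
  sval (cid (empirical_measure_exists x)).

Lemma empirical_measureE (N : nat) (x : 'I_N.+1 -> S) B : borel_set B ->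
  fine (empirical_measure x B) = N.+1%:R^-1 * \sum_(i < N.+1) \1_B (x i).
Proof. exact: (svalP (cid (empirical_measure_exists x))). Qed.

End empirical_measure.

Section empirical_expectation.
Context {R : realType} {S : ptopologicalType} (hS : hausdorff_space S).
Context {d : measure_display} {Omega : measurableType d} (P : probability Omega R)
  (X : nat -> {RV P >-> borel S}) (hX : exchangeable P X).

Definition empirical (n : nat) (w : Omega) : radon_probability R S :=
  empirical_measure hS (fun i : 'I_n.+1 => X i w).

Definition coord_indic (B : set S) (i : nat) (w : Omega) : R := \1_B (X i w).

Lemma bounded_measurable_coord_indic B i : borel_set B ->
  bounded_measurable (coord_indic B i).
Proof.
move=> mB; rewrite (_ : coord_indic B i = \1_(X i @^-1` B)).
  apply: bounded_measurable_indic; rewrite -[X in measurable X]setTI.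
  exact: (measurable_funPT (X i)).
by apply/funext => w; rewrite /coord_indic !indicE; congr (_%:R); congr (nat_of_bool _);
  apply/idP/idP; rewrite !inE.
Qed.

Lemma bounded_measurable_empirical n B : borel_set B ->
  bounded_measurable (fun w => fine (empirical n w B)).
Proof.
move=> mB; under eq_fun do rewrite empirical_measureE//.
apply: bounded_measurableM; first exact: bounded_measurable_cst.
by apply: bounded_measurable_sum => i; exact: bounded_measurable_coord_indic.
Qed.

Lemma expect_rectangle k (f : 'I_k -> nat) (B : 'I_k -> set S) :
  (forall i, borel_set (B i)) ->
  \int[P]_w \prod_(i < k) coord_indic (B i) (f i) w =
  fine (P [set w | forall i, B i (X (f i) w)]).
Proof.
move=> mB; rewrite -expect_indic; last exact: (measurable_rectangle X f mB).
apply: eq_Rintegral => w _; rewrite indicE.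
have [h|h] := boolP (w \in [set w | forall i, B i (X (f i) w)]).
  rewrite big1// => i _; rewrite /coord_indic indicE mem_set//.
  by move: h; rewrite inE.
have /existsNP[i nBi] : ~ forall i, B i (X (f i) w).
  by move=> h'; move/negP: h; apply; rewrite inE.
by rewrite (bigD1 i)//= /coord_indic indicE memNset// mul0r.
Qed.

Lemma bounded_measurable_rectangle k (f : 'I_k -> nat) (B : 'I_k -> set S) :
  (forall i, borel_set (B i)) ->
  bounded_measurable (fun w => \prod_(i < k) coord_indic (B i) (f i) w).
Proof.
move=> mB; apply: bounded_measurable_prod => i.
exact: bounded_measurable_coord_indic.
Qed.

Lemma expect_identical i B : borel_set B ->
  \int[P]_w coord_indic B i w = fine (distribution P (X 0%N) B).
Proof.
move=> mB.
have := @exchangeable_injection _ _ _ _ _ P X 1%N (fun=> i) (fun=> B) hX.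
have -> : [set w | forall _ : 'I_1, B (X i w)] = X i @^-1` B.
  by apply/seteqP; split => w //=; move/(_ ord0).
have -> : [set w | forall j : 'I_1, B (X j w)] = X 0%N @^-1` B.
  apply/seteqP; split => w /=; first by move/(_ ord0).
  by move=> h j; rewrite (ord1 j).
move=> h; rewrite /distribution /pushforward -h//; last first.
  by move=> j j' _; rewrite (ord1 j) (ord1 j').
rewrite -expect_indic; last first.
  by rewrite -[X in measurable X]setTI; exact: (measurable_funPT (X i)).
by apply: eq_Rintegral => w _; rewrite /coord_indic !indicE; congr (_%:R);
  congr (nat_of_bool _); apply/idP/idP; rewrite !inE.
Qed.

Lemma expect_empirical n B : borel_set B ->
  \int[P]_w fine (empirical n w B) = fine (distribution P (X 0%N) B).
Proof.
move=> mB.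
transitivity (\int[P]_w (n.+1%:R^-1 * \sum_(i < n.+1) coord_indic B i w)).
  by apply: eq_Rintegral => w _; rewrite empirical_measureE.
have bX (i : 'I_n.+1) := bounded_measurable_coord_indic i mB.
rewrite expectZ; last exact: bounded_measurable_sum.
rewrite expect_sum//; under eq_bigr do rewrite expect_identical//.
by rewrite sumr_const card_ord -[X in _ * X]mulr_natl mulKf.
Qed.

(** Expanding the product of empirical frequencies gives one term for each map
    ['I_k -> 'I_n.+1].  Exchangeability evaluates the terms of the injective
    maps, and the other maps are a fraction [O(k ^ 2 / n)] of all of them. *)
Lemma expect_empirical_prod n k (B : 'I_k -> set S) :
  (forall i, borel_set (B i)) ->
  \int[P]_w \prod_(i < k) fine (empirical n w (B i)) <=
  fine (P [set w | forall i : 'I_k, B i (X i w)]) + k%:R ^+ 2 / n.+1%:R.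
Proof.
move=> mB; set p := fine (P _).
have mrect : measurable [set w | forall i : 'I_k, B i (X i w)].
  exact: (measurable_rectangle X (fun i => i : nat) mB).
have p01 : 0 <= p <= 1 by rewrite fine_probability_ge0 fine_probability_le1.
(* [c] is the weight of a single map ['I_k -> 'I_n.+1]. *)
pose c : R := n.+1%:R^-1 ^+ k.
have c0 : 0 <= c by rewrite exprn_ge0// invr_ge0.
have -> : \int[P]_w \prod_(i < k) fine (empirical n w (B i)) =
    c * \sum_(g : {ffun 'I_k -> 'I_n.+1})
      fine (P [set w | forall i, B i (X (g i) w)]).
  transitivity (\int[P]_w (c * \sum_(g : {ffun 'I_k -> 'I_n.+1})
      \prod_(i < k) coord_indic (B i) (g i) w)).
    apply: eq_Rintegral => w _.
    under eq_bigr do rewrite empirical_measureE//.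
    rewrite big_split/= prodr_const card_ord; congr (_ * _).
    by rewrite bigA_distr_bigA.
  have br (g : {ffun 'I_k -> 'I_n.+1}) :=
    bounded_measurable_rectangle (fun i => g i : nat) mB.
  rewrite expectZ; last exact: bounded_measurable_sum.
  rewrite expect_sum//; congr (_ * _); apply: eq_bigr => g _.
  by rewrite expect_rectangle.
rewrite (bigID (fun g : {ffun 'I_k -> 'I_n.+1} => injectiveb g))/=.
set I1 := \sum_(g : {ffun 'I_k -> 'I_n.+1} | injectiveb g) _.
set I2 := \sum_(g : {ffun 'I_k -> 'I_n.+1} | ~~ injectiveb g) _.
pose a : R := (n.+1 ^_ k)%:R.
have card_inj : #|[pred g : {ffun 'I_k -> 'I_n.+1} | injectiveb g]| = (n.+1 ^_ k)%N.
  by have := card_inj_ffuns 'I_k 'I_n.+1; rewrite !card_ord cardsE.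
have I1E : I1 = a * p.
  rewrite /I1 (eq_bigr (fun=> p)).
    rewrite sumr_const -[p *+ _]mulr_natl /a -card_inj.
    by congr (_%:R * _); exact: eq_card.
  move=> g /injectiveP gI; congr fine.
  have fI : injective (fun i => g i : nat) by move=> i j /val_inj/gI.
  exact: (exchangeable_injection hX fI mB).
have I2E : I2 <= n.+1%:R ^+ k - a.
  apply: (@le_trans _ _ (\sum_(g : {ffun 'I_k -> 'I_n.+1} | ~~ injectiveb g) 1)).
    apply: ler_sum => g _; apply: fine_probability_le1.
    exact: (measurable_rectangle X (fun i => g i : nat) mB).
  rewrite sumr_const lerBrDl /a -natrD -natrX ler_nat.
  have := cardC [pred g : {ffun 'I_k -> 'I_n.+1} | injectiveb g].
  rewrite card_ffun !card_ord card_inj => <-; rewrite leq_add2l.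
  by apply/eq_leq/eq_card => g; rewrite !inE.
have ha : n.+1%:R ^+ k * (1 - k%:R ^+ 2 / n.+1%:R) <= a.
  exact: ffact_collision.
have cN : c * n.+1%:R ^+ k = 1 by rewrite -exprMn mulVf// expr1n.
pose q : R := k%:R ^+ 2 / n.+1%:R; rewrite -/q in ha *.
have q0 : 0 <= q by rewrite divr_ge0// exprn_ge0.
have {ha}ha : 1 - q <= c * a.
  by have := ler_wpM2l c0 ha; rewrite mulrA cN mul1r.
have : c * I2 <= 1 - c * a by have := ler_wpM2l c0 I2E; rewrite mulrBr cN.
rewrite I1E mulrDr mulrA; set r := c * a in ha *.
by move/andP: p01 => [p0 p1]; nra.
Qed.

End empirical_expectation.

(** * Existence of the mixing measure *)

Section lower_semicontinuous_product.
Context {T : topologicalType} {R : realType}.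

(** For [t >= 0], [t < f x * g x] holds exactly when [a < f x] and [b < g x] for
    some nonnegative [a] and [b] with [t <= a * b]. *)
Lemma open_gtM (f g : T -> R) : (forall x, 0 <= f x) -> (forall x, 0 <= g x) ->
  (forall t, open [set x | t < f x]) -> (forall t, open [set x | t < g x]) ->
  forall t, open [set x | t < f x * g x].
Proof.
move=> f0 g0 of_ og t; have [t0|t0] := ltP t 0.
  rewrite (_ : [set _ | _] = setT); first exact: openT.
  by apply/seteqP; split => // x _ /=; rewrite (lt_le_trans t0)// mulr_ge0.
pose D := [set p : R * R | [/\ 0 <= p.1, 0 <= p.2 & t <= p.1 * p.2]].
rewrite (_ : [set _ | _] =
    \bigcup_(p in D) ([set x | p.1 < f x] `&` [set x | p.2 < g x])).
  by apply: bigcup_open => p _; exact: openI.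
apply/seteqP; split => x /=; last first.
  by move=> [[a b] [/= a0 b0 tab] [/= af bg]]; rewrite (le_lt_trans tab)// ltr_pM.
move=> tfg; have fx : 0 < f x.
  by rewrite lt_neqAle f0 andbT; apply: contraTneq tfg => <-; rewrite mul0r -leNgt.
pose b := (t / f x + g x) / 2.
have tb : t / f x < g x by rewrite ltr_pdivrMr// mulrC.
have tf0 : 0 <= t / f x by rewrite divr_ge0.
have b0 : 0 < b by rewrite /b; lra.
pose a := (t / b + f x) / 2.
have ta : t / b < f x.
  by rewrite ltr_pdivrMr// mulrC -ltr_pdivrMr//; rewrite /b; lra.
have tb0 : 0 <= t / b by rewrite divr_ge0// ltW.
exists (a, b); split => /=.
- by rewrite /a; lra.
- exact: ltW.
- by rewrite -ler_pdivrMr// /a; lra.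
- by rewrite /a; lra.
- by rewrite /b; lra.
Qed.

Lemma open_gt_prod (I : Type) (s : seq I) (F : I -> T -> R) :
  (forall i x, 0 <= F i x) -> (forall i t, open [set x | t < F i x]) ->
  forall t, open [set x | t < \prod_(i <- s) F i x].
Proof.
move=> F0 oF; elim: s => [|i s IH] t.
  under eq_set do rewrite big_nil; have [t1|t1] := ltP t 1.
    by rewrite (_ : [set _ | _] = setT); [exact: openT|apply/seteqP; split].
  rewrite (_ : [set _ | _] = set0); first exact: open0.
  by apply/seteqP; split => // x /=; rewrite ltNge t1.
under eq_set do rewrite big_cons; apply: open_gtM => // x.
by apply: prodr_ge0.
Qed.

End lower_semicontinuous_product.

Section mixing_measure.
Context {R : realType} {S : ptopologicalType} (hS : hausdorff_space S).
Context {d : measure_display} {Omega : measurableType d} (P : probability Omega R)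
  (X : nat -> {RV P >-> borel S}) (hX : exchangeable P X)
  (hradon : radon (distribution P (X 0%N))).
Notation T := (radon_probability R S).
Let emp n w : T := empirical hS X n w.
Let nu : probability (borel S) R := distribution P (X 0%N).

(** The open sets to which the law of every empirical measure can be applied.
    Arbitrary open sets may have non-measurable preimages, since the empirical
    measures need not be Borel maps into the A-topology. *)
Let GG := [set G : set T | open G /\ forall n, measurable (emp n @^-1` G)].

Let GG_eval (G : set S) (a : R) : open G -> GG [set mu : T | a < fine (mu G)].
Proof.
move=> oG; split; first exact: open_eval_gt.
move=> n; have [mf _] := bounded_measurable_empirical hS X n (borel_open oG).
rewrite (_ : _ @^-1` _ = (fun w => fine (emp n w G)) @^-1` `]a, +oo[); last first.
  by apply/seteqP; split => w /=; rewrite in_itv/= andbT.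
by rewrite -[X in measurable X]setTI; exact: mf.
Qed.

Let GG0 : GG set0.
Proof. by split; [exact: open0|move=> n; rewrite preimage_set0]. Qed.

Let GGT : GG setT.
Proof. by split; [exact: openT|move=> n; rewrite preimage_setT]. Qed.

Let GGU G H : GG G -> GG H -> GG (G `|` H).
Proof.
move=> [oG mG] [oH mH]; split; first exact: openU.
by move=> n; rewrite preimage_setU; exact: measurableU.
Qed.

Let GGI G H : GG G -> GG H -> GG (G `&` H).
Proof.
move=> [oG mG] [oH mH]; split; first exact: openI.
by move=> n; rewrite preimage_setI; exact: measurableI.
Qed.

Let GGbase (mu : T) (O : set T) : open O -> O mu ->
  exists G, [/\ GG G, G mu & G `<=` O].
Proof.
move=> oO Omu; have Onbhs : nbhs mu O by exact: open_nbhs_nbhs.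
have [||G a oG aG|G [gG Gmu] GO] := A_nbhs_ind
  (P := fun G => GG G /\ G mu) _ _ _ Onbhs.
- by [].
- by move=> A B [gA Amu] [gB Bmu]; split => //; exact: GGI.
- by split => //; exact: GG_eval.
- by exists G.
Qed.

(** The laws of the empirical measures are uniformly tight: [K j] carries the
    law of [X 0] up to [e / 4 ^ j.+1], so by Markov's inequality an empirical
    measure exceeds [1 / 2 ^ j.+1] outside [K j] with probability at most
    [e / 2 ^ j.+1], and these probabilities add up to [e]. *)
Let tight (e : R) : 0 < e -> exists K : set T, compact K /\
  forall G, GG G -> K `<=` G -> forall n, 1 - e <= fine (P (emp n @^-1` G)).
Proof.
move=> e0; have q0 j : 0 < 2 ^+ j.+1 :> R by rewrite exprn_gt0.
have hK j : exists K : set S, [/\ compact K, K `<=` setT &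
    fine (nu setT) - e / 2 ^+ j.+1 / 2 ^+ j.+1 < fine (nu K)].
  by apply: radon_inner => //; rewrite ?divr_gt0//; exact: (@measurableT _ (borel S)).
pose K j := sval (cid (hK j)).
have cK j : compact (K j) by have [] := svalP (cid (hK j)).
have mK j : borel_set (K j) by exact: borel_compact.
have nuK j : fine (nu (~` K j)) <= e / 2 ^+ j.+1 / 2 ^+ j.+1.
  have [_ _] := svalP (cid (hK j)); rewrite -/(K j).
  have -> : fine (nu setT) = 1 by exact: (congr1 fine (probability_setT nu)).
  have -> : fine (nu (~` K j)) = 1 - fine (nu (K j)).
    exact: (fine_probabilityC nu (mK j)).
  by set a := fine _; lra.
pose eps j : R := (2 ^+ j.+1)^-1.
have epsE j : eps j = (1 / 2) ^+ j.+1 by rewrite /eps div1r exprVn.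
exists [set mu : T | forall j, fine (mu (~` K j)) <= eps j]; split.
  apply: A_compact => // f f0.
  have h2 : `|1 / 2 : R| < 1 by rewrite ger0_norm; lra.
  have [N _ hN] := cvgr_lt _ (cvg_expr h2) _ f0.
  by exists N; rewrite epsE; apply/ltW/hN => /=.
move=> G [oG mG] KG n.
pose Bad j := [set w | eps j < fine (emp n w (~` K j))].
have bmK j := bounded_measurable_empirical hS X n (borelC (mK j)).
have mBad j : measurable (Bad j).
  rewrite (_ : Bad j = (fun w => fine (emp n w (~` K j))) @^-1` `]eps j, +oo[).
    by rewrite -[X in measurable X]setTI; exact: (bmK j).1.
  by apply/seteqP; split => w /=; rewrite in_itv/= andbT.
have PBad j : (P (Bad j) <= (e / (2 ^ j.+1)%:R)%:E)%E.
  rewrite -[leLHS]fineK ?fin_num_measure// lee_fin natrX.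
  have : \int[P]_w (eps j * \1_(Bad j) w) <= \int[P]_w fine (emp n w (~` K j)).
    apply: le_expect => //.
      apply: bounded_measurableM; first exact: bounded_measurable_cst.
      exact: bounded_measurable_indic.
    move=> w; rewrite indicE; have [wB|wB] := boolP (w \in Bad j).
      by rewrite mulr1; rewrite inE in wB; exact: ltW.
    by rewrite mulr0; exact: fine_probability_ge0.
  rewrite expectZ; last exact: bounded_measurable_indic.
  rewrite expect_indic// expect_empirical//; last exact: borelC.
  move=> /le_trans /(_ (nuK j)); rewrite /eps mulrC ler_pdivrMr//.
  by rewrite divfK// lt0r_neq0.
have mU : measurable (\bigcup_j Bad j) by exact: bigcupT_measurable.
have PU : (P (\bigcup_j Bad j) <= e%:E)%E.
  apply: (@le_trans _ _ (\sum_(j <oo) P (Bad j))%E).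
    exact: measure_sigma_subadditive.
  apply: le_trans (epsilon_trick0 xpredT (ltW e0)).
  by apply: lee_nneseries.
have : fine (P (~` \bigcup_j Bad j)) <= fine (P (emp n @^-1` G)).
  apply: le_fine_probability => //; first exact: measurableC.
  move=> w nB; apply: KG => j /=; rewrite leNgt; apply/negP => h.
  by apply: nB; exists j.
rewrite fine_probabilityC//; apply: le_trans; rewrite lerD2l lerN2.
by rewrite -lee_fin fineK// fin_num_measure.
Qed.

Let rect (k : nat) (B : 'I_k -> set S) := [set w | forall i : 'I_k, B i (X i w)].

Let bounded_measurable_moment k (B : 'I_k -> set S) :
  (forall i, borel_set (B i)) ->
  bounded_measurable (fun mu : borel T => \prod_(i < k) fine ((mu : T) (B i))).
Proof.
move=> mB; apply: bounded_measurable_prod => i; exact: bounded_measurable_eval.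
Qed.

Let moment01 k (B : 'I_k -> set S) (mu : T) : (forall i, borel_set (B i)) ->
  0 <= \prod_(i < k) fine (mu (B i)) <= 1.
Proof.
move=> mB; apply/andP; split.
  by apply: prodr_ge0 => i _; exact: fine_probability_ge0.
apply: prodr_ile1 => i _.
by rewrite fine_probability_ge0/= fine_probability_le1//; exact: mB.
Qed.

(** The moments on open sets are integrals of lower semicontinuous functions,
    hence controlled by the measures of the open superlevel sets. *)
Let moment_le_open (Pi : radon_probability R T) (F : set_system nat)
    (FU : UltraFilter F) : \oo `<=` F ->
  (forall G (c : R), GG G -> c < fine (Pi G) ->
    F [set n | c < fine (P (emp n @^-1` G))]) ->
  forall k (G : 'I_k -> set S), (forall i, open (G i)) ->
  \int[Pi]_mu \prod_(i < k) fine ((mu : T) (G i)) <= fine (P (rect G)).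
Proof.
move=> oF hPi k G oG; have mG i := borel_open (oG i).
apply/ler_addgt0Pr => e e0; have e30 : 0 < e / 3 by rewrite divr_gt0.
pose f (mu : T) : R := \prod_(i < k) fine (mu (G i)).
have f01 (mu : T) : 0 <= f mu <= 1 by exact: moment01.
have bf : bounded_measurable (f : borel T -> R) by exact: bounded_measurable_moment.
have bfe n : bounded_measurable (f \o emp n).
  apply: bounded_measurable_prod => i; exact: bounded_measurable_empirical.
have gG t : GG [set mu : T | t < f mu].
  split.
    apply: open_gt_prod => [i mu|i a]; first exact: fine_probability_ge0.
    exact: open_eval_gt.
  move=> n; rewrite (_ : _ @^-1` _ = (f \o emp n) @^-1` `]t, +oo[).
    by rewrite -[X in measurable X]setTI; exact: (bfe n).1.
  by apply/seteqP; split => w /=; rewrite in_itv/= andbT.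
have [N hN] := ltr_add_invr e30; rewrite add0r in hN.
pose A (j : 'I_N.+1) := [set mu : T | j.+1%:R / N.+1%:R < f mu].
have FA : F [set n | forall j, fine (Pi (A j)) - e / 3 < fine (P (emp n @^-1` A j))].
  by apply: filter_forall => j; apply: hPi; [exact: gG|rewrite ltrBlDr ltrDl].
have Fk : F [set n | k%:R ^+ 2 / n.+1%:R < e / 3].
  have k1 : 0 < k%:R ^+ 2 + 1 :> R by rewrite ltr_wpDl// exprn_ge0.
  have [M] := ltr_add_invr (divr_gt0 e30 k1); rewrite add0r ltr_pdivlMr// => hM.
  apply: oF; exists M => // n /= Mn; apply: le_lt_trans hM.
  rewrite mulrC ler_pM ?exprn_ge0 ?invr_ge0 ?lerDl//.
  by rewrite lef_pV2 ?posrE// ler_nat.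
(* Only finitely many conditions are imposed on [n]. *)
have [n [/= nA nk]] := filter_ex (filterI FA Fk).
have /andP[_ up] := layer_cake Pi N bf f01.
have /andP[low _] := layer_cake P N (bfe n) (fun w => f01 (emp n w)).
have mom := expect_empirical_prod hS hX n mG.
have sumA : N.+1%:R^-1 * \sum_(j < N.+1) fine (Pi (A j)) <=
    N.+1%:R^-1 * (\sum_(j < N.+1) fine (P (emp n @^-1` A j))) + e / 3.
  rewrite -[X in _ <= _ + X](mulKf (_ : N.+1%:R != 0))// -mulrDr.
  rewrite ler_wpM2l ?invr_ge0//.
  have -> : N.+1%:R * (e / 3) = \sum_(j < N.+1) (e / 3).
    by rewrite sumr_const card_ord mulr_natl.
  rewrite -big_split/=.
  by apply: ler_sum => j _; rewrite -lerBlDr; exact/ltW.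
have {}up : \int[Pi]_mu f mu <=
  N.+1%:R^-1 * (\sum_(j < N.+1) fine (Pi (A j))) + N.+1%:R^-1 := up.
have {}low : N.+1%:R^-1 * (\sum_(j < N.+1) fine (P (emp n @^-1` A j))) <=
  fine (P (rect G)) + k%:R ^+ 2 / n.+1%:R := le_trans low mom.
apply: (le_trans up); apply: (le_trans (lerD sumA (ltW hN))).
move: low nk; set x := _^-1 * _; set y := fine _; set z := _ / n.+1%:R.
lra.
Qed.

(** Enlarging each [B i] to an open set [G i] can only increase the left-hand
    side, and by outer regularity of the law of [X 0] it increases the
    right-hand side by an arbitrarily small amount. *)
Let moment_le (Pi : radon_probability R T) :
  (forall k (G : 'I_k -> set S), (forall i, open (G i)) ->
    \int[Pi]_mu \prod_(i < k) fine ((mu : T) (G i)) <= fine (P (rect G))) ->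
  forall k (B : 'I_k -> set S), (forall i, borel_set (B i)) ->
  \int[Pi]_mu \prod_(i < k) fine ((mu : T) (B i)) <= fine (P (rect B)).
Proof.
move=> hopen k B mB; apply/ler_addgt0Pr => e e0.
have k10 : 0 < k%:R + 1 :> R by rewrite ltr_wpDl.
have e10 : 0 < e / (k%:R + 1) by rewrite divr_gt0.
have hG i := radon_outer hS hradon (mB i) e10.
pose G i := sval (cid (hG i)).
have oG i : open (G i) by have [] := svalP (cid (hG i)).
have BG i : B i `<=` G i by have [] := svalP (cid (hG i)).
have nuG i : fine (nu (G i)) < fine (nu (B i)) + e / (k%:R + 1).
  by have [] := svalP (cid (hG i)).
have mG i := borel_open (oG i).
have mGB i : borel_set (G i `\` B i).
  exact: (@measurableD _ (borel S) _ _ (mG i) (mB i)).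
apply: (@le_trans _ _ (\int[Pi]_mu \prod_(i < k) fine ((mu : T) (G i)))).
  apply: (le_expect _ (bounded_measurable_moment mB)
    (bounded_measurable_moment mG)) => mu.
  apply: ler_prod => i _; rewrite fine_probability_ge0/=.
  exact: (le_fine_probability mu (mB i) (mG i) (BG i)).
apply: (le_trans (hopen _ _ oG)).
pose ind := @coord_indic R S d Omega P X.
rewrite -(expect_rectangle X (fun i => i : nat) mG).
have bind C i : borel_set C -> bounded_measurable (ind C i).
  by move=> mC; exact: bounded_measurable_coord_indic.
have bs : bounded_measurable (fun w => \sum_(i < k) ind (G i `\` B i) i w).
  by apply: bounded_measurable_sum => i; exact: bind.
have br := bounded_measurable_rectangle X (fun i => i : nat) mB.
have key : \int[P]_w \prod_(i < k) ind (G i) i w <= \int[P]_w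
    (\prod_(i < k) ind (B i) i w + \sum_(i < k) ind (G i `\` B i) i w).
  apply: le_expect; first exact: bounded_measurable_rectangle.
    exact: bounded_measurableD.
  move=> w; have ind01 C i : 0 <= ind C i w <= 1.
    by rewrite /ind /coord_indic indicE; case: (_ \in _); rewrite ?lexx ler01.
  have G1 : \prod_(i < k) ind (G i) i w <= 1 by apply: prodr_ile1.
  have P0 : 0 <= \prod_(i < k) ind (B i) i w.
    by apply: prodr_ge0 => i _; case/andP: (ind01 (B i) i).
  have S0 (I : pred 'I_k) : 0 <= \sum_(i < k | I i) ind (G i `\` B i) i w.
    by apply: sumr_ge0 => i _; case/andP: (ind01 (G i `\` B i) i).
  have [h|/existsNP[i nBi]] := pselect (forall i : 'I_k, B i (X i w)).
    have -> : \prod_(i < k) ind (B i) i w = 1.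
      by rewrite big1// => i _; rewrite /ind /coord_indic indicE mem_set//; exact: h.
    by rewrite (le_trans G1)// lerDl; exact: (S0 xpredT).
  have [Gi|nGi] := pselect (G i (X i w)).
    apply: (le_trans G1); rewrite [X in _ <= _ + X](bigD1 i)//= addrCA.
    rewrite {1}/ind {1}/coord_indic indicE mem_set// lerDl.
    by apply: addr_ge0 => //; exact: S0.
  rewrite [leLHS](bigD1 i)//= {1}/ind {1}/coord_indic indicE memNset// mul0r.
  by rewrite addr_ge0//; exact: (S0 xpredT).
apply: (le_trans key); rewrite expectD// expect_rectangle// expect_sum; last first.
  by move=> i; exact: bind.
rewrite lerD2l; apply: (@le_trans _ _ (\sum_(i < k) (e / (k%:R + 1)))).
  apply: ler_sum => i _; rewrite expect_identical//.
  have := fine_probabilityUI nu (mB i) (mGB i).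
  rewrite setDUK; last exact: BG.
  rewrite setDIK measure0/= addr0 => nuGE.
  have := nuG i; rewrite nuGE ltrD2l => h; exact: ltW h.
rewrite sumr_const card_ord -[_ *+ k]mulr_natl mulrA ler_pdivrMr// mulrC.
by rewrite ler_pM2l// lerDl.
Qed.

(** The moments of the cells of the partition generated by [B] sum to [1] on
    both sides, so none of the inequalities between them can be strict. *)
Let moment_eq (Pi : radon_probability R T) :
  (forall k (B : 'I_k -> set S), (forall i, borel_set (B i)) ->
    \int[Pi]_mu \prod_(i < k) fine ((mu : T) (B i)) <= fine (P (rect B))) ->
  forall k (B : 'I_k -> set S), (forall i, borel_set (B i)) ->
  \int[Pi]_mu \prod_(i < k) fine ((mu : T) (B i)) = fine (P (rect B)).
Proof.
move=> hle k B mB.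
pose C (c : {ffun 'I_k -> bool}) i := if c i then B i else ~` B i.
have mC c i : borel_set (C c i) by rewrite /C; case: ifP => // _; exact: borelC.
pose M c := \int[Pi]_mu \prod_(i < k) fine ((mu : T) (C c i)).
pose Q c := fine (P (rect (C c))).
have MQ c : M c <= Q c by exact: hle.
have sumM : \sum_c M c = 1.
  rewrite /M -expect_sum; last by move=> c; exact: bounded_measurable_moment.
  rewrite -[RHS](expect_cst Pi); apply: eq_Rintegral => mu _.
  rewrite -(bigA_distr_bigA (fun i (b : bool) =>
    fine ((mu : T) (if b then B i else ~` B i)))).
  rewrite big1// => i _; rewrite big_bool/= fine_probabilityC; last exact: mB.
  by rewrite addrC subrK.
have sumQ : \sum_c Q c = 1.
  pose ind := @coord_indic R S d Omega P X.
  rewrite (eq_bigr (fun c => \int[P]_w \prod_(i < k) ind (C c i) i w)); last first.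
    by move=> c _; rewrite expect_rectangle.
  rewrite -expect_sum; last first.
    by move=> c; exact: (bounded_measurable_rectangle X (fun i => i : nat) (mC c)).
  rewrite -[RHS](expect_cst P); apply: eq_Rintegral => w _.
  rewrite -(bigA_distr_bigA (fun i (b : bool) =>
    ind (if b then B i else ~` B i) (i : nat) w)).
  rewrite big1// => i _; rewrite big_bool/= /ind /coord_indic !indicE in_setC.
  by case: (_ \in _); rewrite ?addr0 ?add0r.
pose c0 : {ffun 'I_k -> bool} := [ffun=> true].
have CE : C c0 = B by apply/funext => i; rewrite /C ffunE.
have := hle _ _ mB; rewrite -CE -/(M c0) -/(Q c0) => le0.
apply/eqP; rewrite eq_le le0/=.
move: sumM sumQ; rewrite (bigD1 c0)//= [in X in _ -> X](bigD1 c0)//=.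
set m' := \sum_(_ | _) _; set q' := \sum_(_ | _) _.
have : m' <= q' by apply: ler_sum => c _; exact: MQ.
rewrite -/(M c0) -/(Q c0); lra.
Qed.

(** The mixing measure is the Radon measure induced by a limit, along an
    ultrafilter, of the laws of the empirical measures. *)
Lemma mixing_measure_exists : exists Pi : radon_probability R T,
  forall k (B : 'I_k -> set S), (forall i, borel_set (B i)) ->
  \int[Pi]_mu \prod_(i < k) fine ((mu : T) (B i)) =
  fine (P [set w | forall i : 'I_k, B i (X i w)]).
Proof.
have [F [FU oF]] : exists F : set_system nat, UltraFilter F /\ \oo `<=` F.
  exact: ultraFilterLemma.
have hT : hausdorff_space T by exact: A_hausdorff.
have [Pi hPi] : exists Pi : radon_probability R T, forall G (c : R), GG G ->
    c < fine (Pi G) -> F [set n | c < fine (P (emp n @^-1` G))].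
  apply: (@radon_of_ultralimit R nat F FU T hT GG _ GG0 GGT GGU GGI GGbase
    (fun n G => fine (P (emp n @^-1` G)))).
  - by move=> G [].
  - by move=> n; rewrite preimage_set0 measure0.
  - by move=> n; rewrite preimage_setT probability_setT.
  - move=> n G H [_ mG] [_ mH] GH; apply: le_fine_probability => //.
    exact: preimage_subset.
  - move=> n G H [_ mG] [_ mH]; rewrite preimage_setU preimage_setI.
    exact: fine_probabilityUI.
  - move=> e e0; have [K [cK hK]] := tight e0; exists K; split => // G gG KG.
    by apply: filterS filterT => n _; exact: hK.
by exists Pi; apply: moment_eq; apply: moment_le; exact: moment_le_open FU oF hPi.
Qed.

End mixing_measure.

(** * Polynomial approximation of step functions *)

Section polynomial_step.
Context {R : realType}.

Let bernoulli (y : R) (N : nat) : 0 <= y <= 1 ->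
  1 - N%:R * y <= (1 - y) ^+ N /\ (1 - y) ^+ N * (1 + N%:R * y) <= 1.
Proof.
move=> /andP[y0 y1]; elim: N => [|N [IH1 IH2]].
  by rewrite expr0 mul0r subr0 addr0 mulr1.
have yN0 : 0 <= (1 - y) ^+ N by rewrite exprn_ge0// subr_ge0.
have N0 : 0 <= N%:R :> R by [].
rewrite exprSr -natr1; set t := (1 - y) ^+ N in IH1 IH2 yN0 *.
set n := N%:R in IH1 IH2 N0 *; split.
  have : 0 <= n * y * y by rewrite !mulr_ge0.
  have : 0 <= (t - (1 - n * y)) * (1 - y) by rewrite mulr_ge0; lra.
  by lra.
apply: le_trans IH2.
have : 0 <= t * ((n + 1) * y * y) by rewrite !mulr_ge0; lra.
by lra.
Qed.

(** The Brosowski-Deutsch polynomials: for the exponent [N] next to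
    [theta ^- n], the quantity [N * x ^+ n] tends to [0] or to infinity according to the
    side of [theta] on which [x] lies, and the power is close to [1] or [0]. *)
Definition poly_step (theta : R) (n : nat) (x : R) : R :=
  1 - (1 - x ^+ n) ^+ (Num.truncn (theta ^- n)).+1.

Lemma poly_step01 theta n x : 0 <= x <= 1 -> 0 <= poly_step theta n x <= 1.
Proof.
move=> /andP[x0 x1]; rewrite /poly_step subr_ge0 gerBl.
have xn : 0 <= 1 - x ^+ n <= 1.
  by rewrite subr_ge0 exprn_ile1//= gerBl exprn_ge0.
by case/andP: xn => a b; rewrite exprn_ge0 ?exprn_ile1.
Qed.

Lemma poly_step_cvg1 theta x : 0 < theta -> theta < x <= 1 ->
  poly_step theta n x @[n --> \oo] --> (1 : R).
Proof.
move=> t0 /andP[tx x1]; have x0 : 0 < x by exact: lt_trans tx.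
have tx1 : `|theta / x| < 1.
  by rewrite ger0_norm ?divr_ge0// ?ltW// ltr_pdivrMr// mul1r.
have h := cvg_expr tx1.
apply: (@squeeze_cvgr _ _ _ _ (fun n => 1 - (theta / x) ^+ n) (fun=> 1)).
- apply: nearW => n; set N := (Num.truncn (theta ^- n)).+1.
  have xn : 0 <= x ^+ n <= 1 by rewrite exprn_ge0 ?exprn_ile1// ltW.
  have [_ b] := bernoulli N xn.
  have /andP[p0 p1] := @poly_step01 theta n x (ltac:(by rewrite ltW//=)).
  rewrite p1 andbT /poly_step lerD2l lerN2 -/N exprMn exprVn.
  rewrite ler_pdivlMr ?exprn_gt0//.
  have xn0 : 0 < x ^+ n by rewrite exprn_gt0.
  have tn0 : 0 < theta ^+ n by rewrite exprn_gt0.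
  have Nt : 1 <= N%:R * theta ^+ n.
    by rewrite -ler_pdivrMr// div1r ltW// truncnS_gt.
  set q := (1 - x ^+ n) ^+ N in b *.
  have q0 : 0 <= q by rewrite exprn_ge0// subr_ge0; case/andP: xn.
  have : 0 <= q * x ^+ n * (N%:R * theta ^+ n - 1).
    by rewrite mulr_ge0 ?subr_ge0// mulr_ge0// ltW.
  have : 0 <= theta ^+ n * (1 - q * (1 + N%:R * x ^+ n)).
    by rewrite mulr_ge0 ?subr_ge0// ltW.
  have : 0 <= theta ^+ n * q by rewrite mulr_ge0// ltW.
  by lra.
- rewrite -[X in _ --> X]subr0; apply: cvgB => //; exact: cvg_cst.
- exact: cvg_cst.
Qed.

Lemma poly_step_cvg0 theta x : theta < 1 -> 0 <= x < theta ->
  poly_step theta n x @[n --> \oo] --> (0 : R).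
Proof.
move=> t1 /andP[x0 xt]; have t0 : 0 < theta by exact: le_lt_trans xt.
have x1 : x < 1 by exact: lt_trans t1.
have tx1 : `|x / theta| < 1.
  by rewrite ger0_norm ?divr_ge0// ?ltW// ltr_pdivrMr// mul1r.
have nx1 : `|x| < 1 by rewrite ger0_norm.
apply: (@squeeze_cvgr _ _ _ _ (fun=> 0) (fun n => (x / theta) ^+ n + x ^+ n)).
- apply: nearW => n; set N := (Num.truncn (theta ^- n)).+1.
  have xn : 0 <= x ^+ n <= 1 by rewrite exprn_ge0 ?exprn_ile1// ltW.
  have [a _] := bernoulli N xn.
  have /andP[p0 p1] := @poly_step01 theta n x (ltac:(by rewrite x0 ltW)).
  rewrite p0/= /poly_step -/N.
  have : N%:R * x ^+ n <= (x / theta) ^+ n + x ^+ n.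
    rewrite exprMn exprVn mulrC -[X in _ <= _ + X]mulr1 -mulrDr.
    rewrite ler_wpM2l//; first by case/andP: xn.
    rewrite /N -natr1 lerD2r; have : 0 <= theta ^- n.
      by rewrite invr_ge0 exprn_ge0// ltW.
    by move=> /truncn_itv/andP[].
  by lra.
- exact: cvg_cst.
- by rewrite -[X in _ --> X]addr0; apply: cvgD; exact: cvg_expr.
Qed.

End polynomial_step.

(** * Uniqueness of the mixing measure *)

Section uniqueness.
Context {R : realType} {S : ptopologicalType} (hS : hausdorff_space S).
Notation T := (radon_probability R S).
Let hT : hausdorff_space T. Proof. exact: A_hausdorff. Qed.

(** The algebra generated by the evaluations. Products are allowed with a
    single evaluation only, so that an induction on [eval_poly f] computes the
    integral of [f] times any monomial from the moments. *)
Inductive eval_poly : (T -> R) -> Prop :=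
| eval_poly1 : eval_poly (fun=> 1)
| eval_poly_evalM B f : borel_set B -> eval_poly f ->
    eval_poly (fun mu => fine (mu B) * f mu)
| eval_polyD f g : eval_poly f -> eval_poly g -> eval_poly (fun mu => f mu + g mu)
| eval_polyZ c f : eval_poly f -> eval_poly (fun mu => c * f mu).

Lemma eval_poly_cst c : eval_poly (fun=> c).
Proof.
by have := eval_polyZ c eval_poly1; congr eval_poly; apply/funext => mu; rewrite mulr1.
Qed.

Lemma eval_polyM f g : eval_poly f -> eval_poly g ->
  eval_poly (fun mu => f mu * g mu).
Proof.
move=> pf pg; elim: pf => [|B h mB _ IH|h1 h2 _ IH1 _ IH2|c h _ IH].
- by congr eval_poly: pg; apply/funext => mu; rewrite mul1r.
- by have := eval_poly_evalM mB IH; congr eval_poly; apply/funext => mu; rewrite mulrA.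
- by have := eval_polyD IH1 IH2; congr eval_poly; apply/funext => mu; rewrite mulrDl.
- by have := eval_polyZ c IH; congr eval_poly; apply/funext => mu; rewrite mulrA.
Qed.

Lemma eval_polyC f : eval_poly f -> eval_poly (fun mu => 1 - f mu).
Proof.
move=> pf; have := eval_polyD (eval_poly_cst 1) (eval_polyZ (-1) pf).
by congr eval_poly; apply/funext => mu; rewrite mulN1r.
Qed.

Lemma eval_polyX f n : eval_poly f -> eval_poly (fun mu => f mu ^+ n).
Proof.
move=> pf; elim: n => [|n IH]; first exact: eval_poly1.
by have := eval_polyM pf IH; congr eval_poly; apply/funext => mu; rewrite exprS.
Qed.

Lemma bounded_measurable_eval_poly f : eval_poly f ->
  bounded_measurable (f : borel T -> R).
Proof.
elim=> [|B g mB _ IH|g h _ IHg _ IHh|c g _ IH].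
- exact: bounded_measurable_cst.
- by apply: bounded_measurableM => //; exact: bounded_measurable_eval.
- exact: bounded_measurableD.
- by apply: bounded_measurableM => //; exact: bounded_measurable_cst.
Qed.

(** A polynomial form of Urysohn separation.  Convergence is only pointwise and
    bounded, which is all that integrals see, so indicators of sets given by
    finitely many evaluations can be treated like continuous functions. *)
Definition eval_separated (A O : set T) := exists phi : nat -> T -> R,
  [/\ forall n, eval_poly (phi n), forall n mu, 0 <= phi n mu <= 1,
      forall mu, A mu -> phi^~ mu @ \oo --> (1 : R) &
      forall mu, ~ O mu -> phi^~ mu @ \oo --> (0 : R)].

Let eval_separatedT A : eval_separated A setT.
Proof.
exists (fun _ _ => 1); split => [n|n mu|mu _|mu []//].
- exact: eval_poly1.
- by rewrite ler01 lexx.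
- exact: cvg_cst.
Qed.

Let eval_separated0 O : eval_separated set0 O.
Proof.
exists (fun _ _ => 0); split => [n|n mu|mu []//|mu _].
- exact: eval_poly_cst.
- by rewrite ler01 lexx.
- exact: cvg_cst.
Qed.

Let eval_separatedS A A' O O' : A' `<=` A -> O `<=` O' ->
  eval_separated A O -> eval_separated A' O'.
Proof.
move=> AA OO [phi [p p01 p1 p0]]; exists phi; split => // mu.
- by move=> /AA; exact: p1.
- by move=> nO; apply: p0 => /OO.
Qed.

Let eval_separatedI A B O O' : eval_separated A O -> eval_separated B O' ->
  eval_separated (A `&` B) (O `&` O').
Proof.
move=> [f [pf f01 f1 f0]] [g [pg g01 g1 g0]].
exists (fun n mu => f n mu * g n mu); split => [n|n mu|mu [Amu Bmu]|mu nO].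
- exact: eval_polyM.
- have /andP[a b] := f01 n mu; have /andP[c e] := g01 n mu.
  by rewrite mulr_ge0// mulr_ile1.
- by rewrite -[X in _ --> X]mulr1; apply: cvgM; [exact: f1|exact: g1].
- have [Omu|nOmu] := pselect (O mu).
    have nO' : ~ O' mu by move=> O'mu; apply: nO.
    apply: (@squeeze_cvgr _ _ _ _ (fun=> 0) (g^~ mu)); [|exact: cvg_cst|exact: g0].
    apply: nearW => n; have /andP[a b] := f01 n mu; have /andP[c e] := g01 n mu.
    by rewrite mulr_ge0//= ler_piMl.
  apply: (@squeeze_cvgr _ _ _ _ (fun=> 0) (f^~ mu)); [|exact: cvg_cst|exact: f0].
  apply: nearW => n; have /andP[a b] := f01 n mu; have /andP[c e] := g01 n mu.
  by rewrite mulr_ge0//= ler_piMr.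
Qed.

Let eval_separatedC A O : eval_separated A O -> eval_separated (~` O) (~` A).
Proof.
move=> [f [pf f01 f1 f0]]; exists (fun n mu => 1 - f n mu).
split => [n|n mu|mu nO|mu /contrapT Amu].
- exact: eval_polyC.
- by have /andP[a b] := f01 n mu; lra.
- by rewrite -[X in _ --> X]subr0; apply: cvgB; [exact: cvg_cst|exact: f0].
- by rewrite -(subrr (1 : R)); apply: cvgB; [exact: cvg_cst|exact: f1].
Qed.

Let eval_separatedU A B O : eval_separated A O -> eval_separated B O ->
  eval_separated (A `|` B) O.
Proof.
move=> sA sB; have := eval_separatedC
  (eval_separatedI (eval_separatedC sA) (eval_separatedC sB)).
by rewrite setIid setCK setCI !setCK.
Qed.

(** The threshold of the steps is put strictly between [a] and [mu0 G], so that
    the steps converge on both sides of the gap. *)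
Let eval_separated_eval (G : set S) (mu0 : T) (a : R) : open G ->
  a < fine (mu0 G) ->
  exists2 A, nbhs mu0 A & eval_separated A [set mu : T | a < fine (mu G)].
Proof.
move=> oG aG; have mG := borel_open oG.
have G0 (mu : T) := fine_probability_ge0 mu G.
have G1 (mu : T) := fine_probability_le1 mu mG.
have [a0|a0] := ltP a 0.
  exists setT; first exact: filterT.
  apply: eval_separatedS (eval_separatedT setT) => // mu _ /=.
  exact: lt_le_trans (G0 mu).
pose theta := (a + fine (mu0 G)) / 2.
have G1mu0 := G1 mu0.
have [t0 at_ tG t1] : [/\ 0 < theta, a < theta, theta < fine (mu0 G) & theta < 1].
  by move: (fine _) aG G1mu0 @theta => x; split; lra.
exists [set mu : T | theta < fine (mu G)].
  by apply: open_nbhs_nbhs; split => //; exact: open_eval_gt.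
exists (fun n mu => poly_step theta n (fine (mu G))).
split => [n|n mu|mu tmu|mu /negP].
- apply: eval_polyC; apply: eval_polyX; apply: eval_polyC; apply: eval_polyX.
  have := eval_poly_evalM mG eval_poly1.
  by congr eval_poly; apply/funext => mu; rewrite mulr1.
- by apply: poly_step01; rewrite G0 G1.
- by apply: poly_step_cvg1 => //; rewrite G1 andbT.
- by rewrite -leNgt => h; apply: poly_step_cvg0 => //; rewrite G0/= (le_lt_trans h).
Qed.

Lemma compact_eval_separated (K O : set T) : compact K -> open O -> K `<=` O ->
  eval_separated K O.
Proof.
move=> cK oO KO; apply: (@compact_ind _ K (eval_separated^~ O) cK).
- exact: eval_separated0.
- by move=> A B AB; exact: eval_separatedS.
- by move=> A B; exact: eval_separatedU.
- move=> mu0 Kmu0; have Onbhs : nbhs mu0 O.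
    by apply: open_nbhs_nbhs; split => //; exact: KO.
  have [|A B [A' nA sA] [B' nB sB]|G a oG aG|B [A' nA sA] BO] := A_nbhs_ind
    (P := fun B => exists2 A, nbhs mu0 A & eval_separated A B) _ _ _ Onbhs.
  + by exists setT; [exact: filterT|exact: eval_separatedT].
  + by exists (A' `&` B'); [exact: filterI|exact: eval_separatedI].
  + exact: eval_separated_eval.
  + by exists A' => //; exact: eval_separatedS sA.
Qed.

Variables Pi1 Pi2 : radon_probability R T.
Hypothesis moments : forall k (B : 'I_k -> set S), (forall i, borel_set (B i)) ->
  \int[Pi1]_mu \prod_(i < k) fine ((mu : T) (B i)) =
  \int[Pi2]_mu \prod_(i < k) fine ((mu : T) (B i)).

(* The default value [set0] of [nth] is Borel, so the index may exceed the
   length of [s]. *)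
Let moments_seq (s : seq (set S)) : (forall i, borel_set (nth set0 s i)) ->
  \int[Pi1]_mu \prod_(B <- s) fine ((mu : T) B) =
  \int[Pi2]_mu \prod_(B <- s) fine ((mu : T) B).
Proof.
move=> ms; have := moments (B := fun i : 'I_(size s) => nth set0 s i) (fun i => ms i).
have E (Pi : radon_probability R T) :
    \int[Pi]_mu \prod_(B <- s) fine ((mu : T) B) =
    \int[Pi]_mu \prod_(i < size s) fine ((mu : T) (nth set0 s i)).
  by apply: eq_Rintegral => mu _; rewrite (big_nth set0) big_mkord.
by rewrite !E.
Qed.

Let expect_eval_poly f : eval_poly f -> \int[Pi1]_mu f mu = \int[Pi2]_mu f mu.
Proof.
have bmono s : (forall i, borel_set (nth set0 s i)) -> bounded_measurable
    (fun mu : borel T => \prod_(B <- s) fine ((mu : T) B)).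
  move=> ms; under eq_fun do rewrite (big_nth set0).
  by apply: bounded_measurable_prod => i; exact: bounded_measurable_eval.
move=> pf; suff h s : (forall i, borel_set (nth set0 s i)) ->
    \int[Pi1]_mu (f mu * \prod_(B <- s) fine ((mu : T) B)) =
    \int[Pi2]_mu (f mu * \prod_(B <- s) fine ((mu : T) B)).
  have E (Pi : radon_probability R T) : \int[Pi]_mu f mu =
      \int[Pi]_mu (f mu * \prod_(B <- [::]) fine ((mu : T) B)).
    by apply: eq_Rintegral => mu _; rewrite big_nil mulr1.
  by rewrite !E; apply: h => i; rewrite nth_nil; exact: borel_open open0.
elim: pf s => [|B g mB pg IH|g h pg IHg ph IHh|c g pg IH] s ms.
- have E (Pi : radon_probability R T) :
      \int[Pi]_mu (1 * \prod_(B <- s) fine ((mu : T) B)) =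
      \int[Pi]_mu \prod_(B <- s) fine ((mu : T) B).
    by apply: eq_Rintegral => mu _; rewrite mul1r.
  by rewrite !E; exact: moments_seq.
- have E (Pi : radon_probability R T) : \int[Pi]_mu
      (fine ((mu : T) B) * g mu * \prod_(B <- s) fine ((mu : T) B)) =
      \int[Pi]_mu (g mu * \prod_(B <- B :: s) fine ((mu : T) B)).
    by apply: eq_Rintegral => mu _; rewrite big_cons mulrCA mulrA.
  by rewrite !E; apply: IH => -[|i] //=.
- have E (Pi : radon_probability R T) : \int[Pi]_mu
      ((g mu + h mu) * \prod_(B <- s) fine ((mu : T) B)) =
      \int[Pi]_mu (g mu * \prod_(B <- s) fine ((mu : T) B)) +
      \int[Pi]_mu (h mu * \prod_(B <- s) fine ((mu : T) B)).
    rewrite -expectD; try by apply: bounded_measurableM => //;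
      [exact: bounded_measurable_eval_poly|exact: bmono].
    by apply: eq_Rintegral => mu _; rewrite mulrDl.
  by rewrite !E IHg// IHh.
- have E (Pi : radon_probability R T) : \int[Pi]_mu
      (c * g mu * \prod_(B <- s) fine ((mu : T) B)) =
      c * \int[Pi]_mu (g mu * \prod_(B <- s) fine ((mu : T) B)).
    rewrite -expectZ; last by apply: bounded_measurableM => //;
      [exact: bounded_measurable_eval_poly|exact: bmono].
    by apply: eq_Rintegral => mu _; rewrite mulrA.
  by rewrite !E IH.
Qed.

(** Both measures integrate the separating polynomials alike, and in the limit
    these integrals dominate [Pi1 K] and are dominated by [Pi2 V]; the open
    neighbourhood [V] of [K] is then shrunk by outer regularity. *)
Lemma radon_moments_unique : Pi1 = Pi2.
Proof.
apply: (radon_probability_le_compact_eq hT) => K cK.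
have mK := borel_compact hT cK.
apply/ler_addgt0Pr => e e0.
have [V [oV KV Ve]] := radon_outer hT (radon_probability_radon Pi2) mK e0.
have mV := borel_open oV; have mVC := borelC mV.
apply: le_trans (ltW Ve).
have [phi [p p01 p1 p0]] := compact_eval_separated cK oV KV.
have bp n : bounded_measurable (phi n : borel T -> R).
  exact: bounded_measurable_eval_poly.
have lim_on (A : set T) (l : R) : borel_set A ->
    (forall mu, A mu -> phi^~ mu @ \oo --> l) ->
    forall Pi : radon_probability R T,
    (\int[Pi]_mu (phi n mu * \1_A mu)) @[n --> \oo] --> l * fine (Pi A).
  move=> mA phil Pi.
  have bA : bounded_measurable (\1_A : borel T -> R) by exact: bounded_measurable_indic.
  rewrite -expect_indic// -expectZ//; apply: (@expect_cvg _ _ _ _ _ _ 1).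
  - by move=> n; exact: bounded_measurableM.
  - by apply: bounded_measurableM => //; exact: bounded_measurable_cst.
  - move=> n mu; have /andP[a b] := p01 n mu.
    rewrite indicE; case: (_ \in _); rewrite ?mulr1 ?mulr0 ?normr0//.
    by rewrite ger0_norm.
  - move=> mu; rewrite indicE; have [Amu|nAmu] := pselect (A mu).
      rewrite mem_set// mulr1; under eq_cvg do rewrite mulr1; exact: phil.
    rewrite memNset// mulr0; under eq_cvg do rewrite mulr0; exact: cvg_cst.
have := lim_on K 1 mK p1 Pi1; rewrite mul1r => c1.
have := lim_on (~` V) 0 mVC p0 Pi2; rewrite mul0r => c2.
have c3 : (fine (Pi2 V) + \int[Pi2]_mu (phi n mu * \1_(~` V) mu)) @[n --> \oo] -->
    fine (Pi2 V).
  by rewrite -[X in _ --> X]addr0; apply: cvgD => //; exact: cvg_cst.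
apply: (ler_cvg_to c1 c3); apply: nearW => n.
have bI A : borel_set A -> bounded_measurable (\1_A : borel T -> R).
  by move=> mA; exact: bounded_measurable_indic.
apply: (@le_trans _ _ (\int[Pi1]_mu phi n mu)).
  apply: le_expect => // [|mu]; first by apply: bounded_measurableM => //; exact: bI.
  have /andP[a b] := p01 n mu.
  by rewrite indicE; case: (_ \in _); rewrite ?mulr1 ?mulr0.
rewrite expect_eval_poly// -expect_indic// -expectD; [|exact: bI|]; last first.
  by apply: bounded_measurableM => //; exact: bI.
apply: le_expect => // [|mu].
  apply: bounded_measurableD; first exact: bI.
  by apply: bounded_measurableM => //; exact: bI.
have /andP[a b] := p01 n mu; rewrite !indicE in_setC.
by case: (_ \in _); rewrite /= ?mulr1 ?mulr0; lra.
Qed.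

End uniqueness.

(** * The representation theorem *)

Lemma moment_EFin (R : realType) (S : ptopologicalType)
    (Pi : radon_probability R (radon_probability R S)) (k : nat)
    (B : 'I_k -> set S) : (forall i, borel_set (B i)) ->
  (\int[Pi]_(mu in [set: radon_probability R S]) \prod_(i < k) mu (B i))%E =
  (\int[Pi]_mu \prod_(i < k) fine ((mu : radon_probability R S) (B i)))%:E.
Proof.
move=> mB; rewrite -bounded_measurable_integralE; last first.
  by apply: bounded_measurable_prod => i; exact: bounded_measurable_eval.
apply: eq_integral => mu _; rewrite -prodEFin; apply: eq_bigr => i _.
by rewrite fineK// fin_num_measure//; exact: mB.
Qed.

Local Open Scope ereal_scope.

Theorem theorem2p2 (R : realType) (S : ptopologicalType)
    (hS : hausdorff_space S)
    (d : measure_display) (Omega : measurableType d) (P : probability Omega R)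
    (X : nat -> {RV P >-> borel S}) (hX : exchangeable P X)
    (hradon : radon (distribution P (X 0%N))) :
  exists! Pi : radon_probability R (radon_probability R S),
    forall (k : nat) (B : 'I_k -> set S), (forall i, borel_set (B i)) ->
      P [set w | forall i : 'I_k, B i (X i w)] =
      \int[Pi]_(mu in [set: radon_probability R S]) \prod_(i < k) mu (B i).
Proof.
have [Pi hPi] := mixing_measure_exists hS hX hradon.
exists Pi; split.
  move=> k B mB; rewrite moment_EFin// hPi// fineK// fin_num_measure//.
  exact: (measurable_rectangle X (fun i => i : nat) mB).
move=> Pi' hPi'; apply: (radon_moments_unique hS) => k B mB.
apply: EFin_inj; rewrite -!moment_EFin// -hPi'// moment_EFin// hPi//.
rewrite fineK// fin_num_measure//.
exact: (measurable_rectangle X (fun i => i : nat) mB).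
Qed.
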